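(* There exist a Fuchsian meromorphic connection $\nabla$ on the tangent bundle of $\mathbb{CP}^1$ and a geodesic $\gamma$ of $\nabla$ such that $\gamma$ has infinitely many self-intersections and $\gamma$ is not everywhere dense in $\mathbb{CP}^1$.
   Context: Let $X$ be a Riemann surface. A meromorphic connection on $TX$ is a $\mathbb{C}$-linear operator $\nabla$ from (germs of) meromorphic sections of $TX$ to (germs of) meromorphic sections of $TX$ tensored with meromorphic $1$-forms, satisfying the Leibniz rule $\nabla(fs)=s\otimes df+f\nabla(s)$. In a local coordinate $z$ one has $\nabla(\partial_z)=\partial_z\otimes\eta$ with $\eta$ a meromorphic $1$-form. The connection is called Fuchsian if $\eta$ has at most simple poles in every local coordinate; $\Sigma$ denotes the set of poles of $\nabla$. A geodesic of $\nabla$ is a smooth real curve $\gamma(t)$ in $X\setminus\Sigma$ with $\nabla_{\gamma(t)}(\dot\gamma(t))(\dot\gamma(t))=0$ for all $t$ (it may be allowed to start at a point of $\Sigma$). Equivalently, in every affine chart $\phi$ of $\nabla$ one locally has $\phi(\gamma(t))=at+b$ with $a,b\in\mathbb{C}$. Here an affine chart of $\nabla$ is a holomorphic coordinate chart $\phi:U\to\mathbb{C}$, $U\subset X\setminus\Sigma$ open and simply connected, such that $\nabla|_{TU}$ is the pull-back under $(\phi,d\phi)$ of the standard connection on $T\mathbb{C}=\mathbb{C}\times\mathbb{C}$ (the one whose horizontal sections are the constant vector fields). *)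

(* Defs.v *)
From Stdlib Require Import Reals List.
From Coquelicot Require Import Coquelicot.

Open Scope C_scope.

(** * The Riemann sphere *)

(* [Some z] is the point of affine coordinate z, [None] is infinity. *)
Definition CP1 : Type := option C.

(* Around every point p we use the standard coordinate u centred at p:
   u = z - a if p = Some a, and u = 1/z if p = None.  [zparam p] gives z as a
   function of u (at p = None it is meaningless for u = 0), [dzparam p] is
   dz/du, and [chart p] is the inverse chart u |-> point of CP1. *)
Definition zparam (p : CP1) (u : C) : C :=
  match p with Some a => a + u | None => / u end.

Definition dzparam (p : CP1) (u : C) : C :=
  match p with Some _ => 1 | None => - / (u * u) end.

Definition chart (p : CP1) (u : C) : CP1 :=
  match p with
  | Some a => Some (a + u)
  | None => if Ceq_dec u 0 then None else Some (/ u)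
  end.

Definition open_CP1 (U : CP1 -> Prop) : Prop :=
  forall p : CP1, open (fun u : C => U (chart p u)).

Definition dense_CP1 (A : CP1 -> Prop) : Prop :=
  forall U : CP1 -> Prop,
    open_CP1 U -> (exists q, U q) -> exists q, U q /\ A q.

(** * Meromorphic germs *)

(* A germ at p of a meromorphic object is determined by its values at the
   points close to p and different from p.  All these points are finite, so the
   germ is encoded by a function C -> C of the coordinate z, namely the
   coefficient of the object in the frame
     1 for functions, d/dz for vector fields, dz for 1-forms,
     d/dz (x) dz for sections of TX (x) T*X.
   This is also the case at p = None; the order of the germ is
   then read in the frame attached to the coordinate u = 1/z. Values on a
   discrete set are irrelevant, and two functions define the same germ at p when
   they agree in the sense of [near p]. *)
Definition near (p : CP1) (P : C -> Prop) : Prop :=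
  locally' (0 : C) (fun u : C => P (zparam p u)).

Definition germ_eq (p : CP1) (f g : C -> C) : Prop :=
  near p (fun z => f z = g z).

(* f(u) = sum_n c_n u^(n - N) on a punctured neighbourhood of u = 0. *)
Definition laurent (N : nat) (c : nat -> C) (f : C -> C) : Prop :=
  locally' (0 : C) (fun u : C =>
    is_pseries (K := C_AbsRing) (V := C_NormedModule) c u (u ^ N * f u)).

Definition pole_order_le (N : nat) (f : C -> C) : Prop :=
  exists c : nat -> C, laurent N c f.

(* The change of frame is d/dz = (dz/du)^-1 d/du and dz = (dz/du) du; hence
   d/dz (x) dz = d/du (x) du. *)
Definition meromorphic_fun (p : CP1) (F : C -> C) : Prop :=
  exists N, pole_order_le N (fun u => F (zparam p u)).

Definition meromorphic_field (p : CP1) (s : C -> C) : Prop :=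
  exists N, pole_order_le N (fun u => s (zparam p u) / dzparam p u).

Definition meromorphic_field_form (p : CP1) (T : C -> C) : Prop :=
  exists N, pole_order_le N (fun u => T (zparam p u)).

Definition form_pole_order_le (N : nat) (p : CP1) (eta : C -> C) : Prop :=
  pole_order_le N (fun u => eta (zparam p u) * dzparam p u).

(** * Meromorphic connections on the tangent bundle *)

(* [nabla] acts on coefficient functions; by [nabla_local] it induces an
   operator on germs at every point.  Nothing is required of its values on
   functions which are not meromorphic at the point considered. *)
Record meromorphic_connection : Type := {
  nabla :> (C -> C) -> (C -> C);
  nabla_local : forall (p : CP1) (s1 s2 : C -> C),
    meromorphic_field p s1 -> meromorphic_field p s2 ->
    germ_eq p s1 s2 -> germ_eq p (nabla s1) (nabla s2);
  nabla_meromorphic : forall (p : CP1) (s : C -> C),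
    meromorphic_field p s -> meromorphic_field_form p (nabla s);
  nabla_add : forall (p : CP1) (s1 s2 : C -> C),
    meromorphic_field p s1 -> meromorphic_field p s2 ->
    germ_eq p (nabla (fun z => s1 z + s2 z))
              (fun z => nabla s1 z + nabla s2 z);
  nabla_scale : forall (p : CP1) (k : C) (s : C -> C),
    meromorphic_field p s ->
    germ_eq p (nabla (fun z => k * s z)) (fun z => k * nabla s z);
  nabla_leibniz : forall (p : CP1) (F s : C -> C),
    meromorphic_fun p F -> meromorphic_field p s ->
    germ_eq p (nabla (fun z => F z * s z))
              (fun z => s z * C_derive F z + F z * nabla s z)
}.

(* zeta, viewed as a function of z, extends holomorphically to p with non-zero
   derivative with respect to u at p. *)
Definition local_coordinate (p : CP1) (zeta : C -> C) : Prop :=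
  exists c : nat -> C,
    laurent 0 c (fun u => zeta (zparam p u)) /\ c 1%nat <> 0.

(* d/dzeta = (dzeta/dz)^-1 d/dz *)
Definition coordinate_field (zeta : C -> C) : C -> C :=
  fun z => / C_derive zeta z.

(* nabla (d/dzeta) = d/dzeta (x) eta near p *)
Definition connection_form (D : meromorphic_connection) (p : CP1)
    (zeta eta : C -> C) : Prop :=
  germ_eq p (D (coordinate_field zeta))
            (fun z => coordinate_field zeta z * eta z).

Definition Fuchsian (D : meromorphic_connection) : Prop :=
  forall (p : CP1) (zeta eta : C -> C),
    local_coordinate p zeta -> connection_form D p zeta eta ->
    form_pole_order_le 1 p eta.

(* The standard coordinate u centred at p, up to an additive constant: z or 1/z. *)
Definition std_coordinate (p : CP1) : C -> C :=
  match p with Some _ => (fun z => z) | None => (fun z => / z) end.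

(* nabla (d/du) = d/du (x) f du, with f(u) = sum_n e_n u^n near u = 0: the
   connection is holomorphic at p. *)
Definition regular_expansion (D : meromorphic_connection) (p : CP1)
    (e : nat -> C) : Prop :=
  exists eta : C -> C,
    connection_form D p (std_coordinate p) eta /\
    laurent 0 e (fun u => eta (zparam p u) * dzparam p u).

Definition is_pole (D : meromorphic_connection) (p : CP1) : Prop :=
  ~ exists e, regular_expansion D p e.

(** * Geodesics *)

(* Near t the curve gamma is smooth; d 0 is its expression in the coordinate
   centred at gamma t and d n is the n-th derivative of d 0. *)
Definition smooth_lift (gamma : R -> CP1) (t : R) (d : nat -> R -> C) : Prop :=
  locally t (fun s : R => gamma s = chart (gamma t) (d 0%nat s)) /\
  locally t (fun s : R => forall n : nat,
    is_derive (K := R_AbsRing) (V := C_R_NormedModule) (d n) s (d (S n) s)).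

(* In a coordinate u with nabla (d/du) = d/du (x) f du, the vector
   nabla_(gamma t) (gamma') (gamma') is (u'' + f(u) u'^2) d/du.  In the
   coordinate centred at gamma t one has u(t) = 0 and f(0) = e 0. *)
Definition geodesic_at (D : meromorphic_connection) (gamma : R -> CP1) (t : R)
    : Prop :=
  exists (d : nat -> R -> C) (e : nat -> C),
    smooth_lift gamma t d /\ regular_expansion D (gamma t) e /\
    d 2%nat t + e 0%nat * (d 1%nat t) ^ 2 = 0.

Definition in_interval (a b : Rbar) (t : R) : Prop :=
  Rbar_lt a t /\ Rbar_lt t b.

(* Only the restriction of gamma to the open interval (a, b) matters. *)
Definition geodesic (D : meromorphic_connection) (a b : Rbar)
    (gamma : R -> CP1) : Prop :=
  Rbar_lt a b /\
  forall t : R, in_interval a b t ->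
    ~ is_pole D (gamma t) /\ geodesic_at D gamma t.

Definition trace (a b : Rbar) (gamma : R -> CP1) (q : CP1) : Prop :=
  exists t : R, in_interval a b t /\ gamma t = q.

Definition R_independent (v w : C) : Prop := Im (v * Cconj w) <> 0%R.

(* Two branches of gamma cross at q with distinct tangent lines.  This excludes
   the points of a simple closed geodesic that is run through several times. *)
Definition self_intersection (a b : Rbar) (gamma : R -> CP1) (q : CP1) : Prop :=
  exists (t1 t2 : R) (d1 d2 : nat -> R -> C),
    in_interval a b t1 /\ in_interval a b t2 /\
    gamma t1 = q /\ gamma t2 = q /\
    smooth_lift gamma t1 d1 /\ smooth_lift gamma t2 d2 /\
    R_independent (d1 1%nat t1) (d2 1%nat t2).

Definition infinitely_many (P : CP1 -> Prop) : Prop :=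
  ~ exists l : list CP1, forall q, P q -> In q l.

(* Main.v *)
Require Import Defs.
From Stdlib Require Import Reals List.
From Coquelicot Require Import Coquelicot.
From Stdlib Require Import Lra Lia Classical.

Open Scope C_scope.

(* On the y-sphere the flat structure d phi = dy / (1 - y^3) is multiplied by a cube root of
   unity under y |-> exp(2 pi i / 3) y, so it induces a Fuchsian connection on the z-sphere,
   z = y^3, with poles 0, 1, infinity and connection form - (2/3) dz/z - dz/(z - 1).  At z = 1
   the residue is -1: the flat metric has a half-infinite cylinder there, and geodesics entering
   it spiral towards z = 1.  The solution of y' = i (1 - y^3), y(0) = -1/2, satisfies
   y(-t) = conj(y(t)) and tends to omega = exp(2 pi i / 3) at +infinity.  Hence z(t) = y(t)^3
   is a geodesic spiralling into z = 1 at both ends, and z(t) = z(-t) each time the spiral meets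
   the real axis.  The two branches are mirror images, and there z'^2 is a real multiple of y, so
   they cross transversally.  The curve stays away from z = 0. *)

(** Meromorphy is defined by Laurent expansions, so convergent power series must first be shown
    stable under products, reciprocals and derivatives. The curve has no closed form, since phi =
    int dy / (1 - y^3) is a sum of three logarithms: it comes from a global existence theorem,
    applied after the field has been made bounded and Lipschitz by a retraction onto a disc.

    That disc is centred at omega and has the starting point on its boundary: with y = omega (1 - E)
    it is |E|^2 <= 3/4, because |-1/2 - omega| = sqrt 3 / 2. On it |E| decreases. This one fact
    makes the retraction harmless, gives the convergence to omega, and keeps y away from 0 because
    |E| < 1.

    The spiralling is read off the linear part at omega: W = 1 - z satisfies W' = kappa W with kappa
    = - 3 i y^2, which tends to - 3 i omega^2, of imaginary part 3/2.

    The crossing points are not shown to be pairwise distinct. Instead, crossings occur at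
    arbitrarily late times, while the curve leaves every point other than 1 for good and never
    reaches 1; hence no finite list contains all of them. *)

Ltac Cring := match goal with |- @eq _ ?a ?b => change (@eq C a b); ring end.
Ltac Rring := match goal with |- @eq _ ?a ?b => change (@eq R a b); ring end.

(** * Derivatives and power series over C *)

Definition is_Cderive (f : C -> C) (z l : C) : Prop :=
  is_derive (K := C_AbsRing) (V := C_NormedModule) f z l.

Lemma is_Cderive_iff f z l : is_Cderive f z l <->
  forall eps, (0 < eps)%R -> exists delta, (0 < delta)%R /\
   forall w, (Cmod (w - z) < delta)%R -> (Cmod (f w - f z - (w - z) * l) <= eps * Cmod (w - z))%R.
Proof.
split.
- intros [_ H] eps Heps.
  specialize (H z (fun P HP => HP) (mkposreal eps Heps)).
  destruct H as [d Hd]. exists d; split; [apply cond_pos|].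
  intros w Hw. exact (Hd w Hw).
- intros H; split.
  + apply (is_linear_scal_l (K:=C_AbsRing) (V:=C_NormedModule)).
  + intros x Hx. rewrite <- (is_filter_lim_locally_unique _ _ Hx).
    intros eps. destruct (H eps (cond_pos eps)) as [d [Hd1 Hd2]].
    exists (mkposreal d Hd1). intros w Hw. exact (Hd2 w Hw).
Qed.

(** C carries two normed-module structures over itself with the same norm, and the product and chain
    rules are stated with the ring one. A derivative sees its target only through linearity and the
    norm, so the remainder estimate transfers unchanged. *)
Lemma is_Cderive_ring f z l :
  is_Cderive f z l <->
  is_derive (K := C_AbsRing) (V := AbsRing_NormedModule C_AbsRing) f z l.
Proof.
split; intros [_ H]; (split; [| exact H]).
- exact (is_linear_scal_l (K := C_AbsRing) (V := AbsRing_NormedModule C_AbsRing) l).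
- exact (is_linear_scal_l (K := C_AbsRing) (V := C_NormedModule) l).
Qed.

Lemma is_Cderive_mult (f g : C->C) z df dg : is_Cderive f z df -> is_Cderive g z dg ->
 is_Cderive (fun x => f x * g x) z (df * g z + f z * dg).
Proof.
intros Hf%is_Cderive_ring Hg%is_Cderive_ring. apply is_Cderive_ring.
exact (is_derive_mult (K:=C_AbsRing) f g z df dg Hf Hg Cmult_comm).
Qed.

Lemma is_Cderive_comp (f g : C->C) z df dg: is_Cderive f (g z) df -> is_Cderive g z dg ->
 is_Cderive (fun x => f (g x)) z (dg * df).
Proof.
intros Hf Hg%is_Cderive_ring.
exact (is_derive_comp (K:=C_AbsRing) (V:=C_NormedModule) f g z df dg Hf Hg).
Qed.

Lemma is_Cderive_plus (f g : C->C) z df dg: is_Cderive f z df -> is_Cderive g z dg ->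
 is_Cderive (fun x => f x + g x) z (df + dg).
Proof.
intros. refine (is_derive_plus (K:=C_AbsRing) (V:=C_NormedModule) f g z df dg _ _); try assumption.
Qed.

Lemma is_Cderive_const (a z : C) : is_Cderive (fun _ => a) z 0.
Proof. exact (is_derive_const (K:=C_AbsRing) (V:=C_NormedModule) a z). Qed.

Lemma is_Cderive_id (z : C) : is_Cderive (fun x => x) z 1.
Proof. apply is_Cderive_ring. exact (is_derive_id (K:=C_AbsRing) z). Qed.

Lemma is_Cderive_inv (z : C) : z <> 0 -> is_Cderive (fun x => / x) z (- / (z * z)).
Proof.
intros Hz. apply is_Cderive_iff. intros eps Heps.
pose proof (proj1 (Cmod_gt_0 z) Hz) as Hp.
set (m := Cmod z) in *.
assert (H3 : (0 < m * m * m)%R) by (repeat apply Rmult_lt_0_compat; assumption).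
(* The remainder is (w - z)^2 / (w z^2). The first radius gives |w| > m / 2, hence the bound 2 |w -
   z|^2 / m^3, and the second radius turns one factor |w - z| into [eps]. *)
exists (Rmin (m / 2) (eps * (m * m * m) / 2)). split.
{ apply Rmin_pos; [lra|]. apply Rdiv_lt_0_compat; [|lra]. apply Rmult_lt_0_compat; assumption. }
intros w Hw.
assert (Hw1 : (Cmod (w - z) < m / 2)%R) by (eapply Rlt_le_trans; [apply Hw|apply Rmin_l]).
assert (Hw2 : (Cmod (w - z) < eps * (m * m * m) / 2)%R) by (eapply Rlt_le_trans; [apply Hw|apply Rmin_r]).
assert (Hwm : (m / 2 < Cmod w)%R).
{ pose proof (Cmod_triangle w (- (w - z))) as T. rewrite Cmod_opp in T.
  replace (w + - (w - z)) with z in T by ring. fold m in T. lra. }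
assert (Hwn : w <> 0) by (apply Cmod_gt_0; lra).
replace (/ w - / z - (w - z) * - / (z * z)) with ((w - z) * ((w - z) / (w * (z * z)))) by (field; auto).
rewrite Cmod_mult, Rmult_comm. apply Rmult_le_compat_r; [apply Cmod_ge_0|].
rewrite Cmod_div by (repeat apply Cmult_neq_0; assumption).
rewrite !Cmod_mult. fold m.
apply Rle_div_l; [repeat apply Rmult_lt_0_compat; lra|].
assert (m / 2 * (m * m) <= Cmod w * (m * m))%R by (apply Rmult_le_compat_r; nra).
nra.
Qed.

Lemma is_Cderive_ext_loc (f g : C->C) z l r : (0 < r)%R ->
  (forall w, (Cmod (w - z) < r)%R -> f w = g w) -> is_Cderive f z l -> is_Cderive g z l.
Proof.
rewrite !is_Cderive_iff. intros Hr E H eps Heps. destruct (H eps Heps) as [d [Hd1 Hd2]].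
exists (Rmin d r). split; [apply Rmin_pos; assumption|]. intros w Hw.
rewrite <- !E. 
- apply Hd2. eapply Rlt_le_trans; [apply Hw|apply Rmin_l].
- replace (z - z) with (RtoC 0) by ring. rewrite Cmod_0; assumption.
- eapply Rlt_le_trans; [apply Hw|apply Rmin_r].
Qed.

Lemma locally_C_iff (z : C) (P : C -> Prop) : locally z P <->
  exists r, (0 < r)%R /\ forall w, (Cmod (w - z) < r)%R -> P w.
Proof.
rewrite locally_C. split.
- intros [d Hd]. exists d. split; [apply cond_pos|]. intros w Hw. apply Hd. exact Hw.
- intros [r [Hr H]]. exists (mkposreal r Hr). intros w Hw. apply H. exact Hw.
Qed.

Lemma locally'_C0_iff (P : C -> Prop) : locally' (0 : C) P <->
  exists r, (0 < r)%R /\ forall w : C, w <> 0 -> (Cmod w < r)%R -> P w.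
Proof.
unfold locally', within. rewrite locally_C_iff.
split; intros [r [Hr H]]; exists r; (split; [assumption|]); intros w.
- intros H1 H2. apply H; [|exact H1]. now replace (w - 0) with w by ring.
- intros H1 H2. apply H; [exact H2|]. now replace w with (w - 0) by ring.
Qed.

(** * Complex series, handled through their real and imaginary parts *)

Definition is_Cseries (a : nat -> C) (l : C) : Prop :=
  is_series (fun n => Re (a n)) (Re l) /\ is_series (fun n => Im (a n)) (Im l).

Lemma Re_sum_n (a : nat -> C) n : Re (sum_n a n) = sum_n (fun n => Re (a n)) n.
Proof. induction n; [now rewrite !sum_O|]. now rewrite !sum_Sn, <- IHn. Qed.

Lemma Im_sum_n (a : nat -> C) n : Im (sum_n a n) = sum_n (fun n => Im (a n)) n.
Proof. induction n; [now rewrite !sum_O|]. now rewrite !sum_Sn, <- IHn. Qed.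

Lemma is_series_C_iff (a : nat -> C) l :
  is_series (K := C_AbsRing) (V := C_NormedModule) a l <-> is_Cseries a l.
Proof.
unfold is_series, is_Cseries; split.
- intros H. split.
  + apply filterlim_ext with (fun n => fst (sum_n a n)); [intros; apply Re_sum_n|].
    eapply filterlim_comp; [exact H|]. apply (continuous_fst (U:=R_UniformSpace) (V:=R_UniformSpace) (fst l) (snd l)).
  + apply filterlim_ext with (fun n => snd (sum_n a n)); [intros; apply Im_sum_n|].
    eapply filterlim_comp; [exact H|]. apply (continuous_snd (U:=R_UniformSpace) (V:=R_UniformSpace) (fst l) (snd l)).
- intros [H1 H2].
  intros P [e He].
  specialize (H1 _ (locally_ball (T := R_UniformSpace) (Re l) e)). specialize (H2 _ (locally_ball (T := R_UniformSpace) (Im l) e)).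
  unfold filtermap in *. generalize (filter_and _ _ H1 H2). apply filter_imp.
  intros n [A B]. apply He. rewrite <- Re_sum_n in A. rewrite <- Im_sum_n in B. split; assumption.
Qed.

Lemma im_le_Cmod (c : C) : (Rabs (Im c) <= Cmod c)%R.
Proof. eapply Rle_trans; [apply Rmax_r|apply Rmax_Cmod]. Qed.

Lemma Cmod_le_Re_Im (c : C) : (Cmod c <= Rabs (Re c) + Rabs (Im c))%R.
Proof.
unfold Cmod. apply Rle_trans with (sqrt ((Rabs (Re c) + Rabs (Im c)) ^ 2)).
- apply sqrt_le_1_alt. rewrite <- (pow2_abs (fst c)), <- (pow2_abs (snd c)).
  pose proof (Rabs_pos (fst c)). pose proof (Rabs_pos (snd c)). unfold Re, Im. nra.
- rewrite sqrt_pow2; [lra|]. pose proof (Rabs_pos (Re c)). pose proof (Rabs_pos (Im c)). lra.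
Qed.

Lemma is_Cseries_unique a l1 l2 : is_Cseries a l1 -> is_Cseries a l2 -> l1 = l2.
Proof.
intros [A1 A2] [B1 B2]. apply injective_projections.
- exact (eq_trans (eq_sym (is_series_unique _ _ A1)) (is_series_unique _ _ B1)).
- exact (eq_trans (eq_sym (is_series_unique _ _ A2)) (is_series_unique _ _ B2)).
Qed.

Lemma is_Cseries_ext a b l : (forall n, a n = b n) -> is_Cseries a l -> is_Cseries b l.
Proof.
intros E [A1 A2]; split; eapply is_series_ext; try eassumption; intros n; simpl; now rewrite E.
Qed.

Lemma is_Cseries_plus a b la lb :
  is_Cseries a la -> is_Cseries b lb -> is_Cseries (fun n => a n + b n) (la + lb).
Proof. intros [A1 A2] [B1 B2]; split; now apply (is_series_plus (K := R_AbsRing) (V := R_NormedModule)). Qed.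

Lemma is_Cseries_scal (k : C) a l :
  is_Cseries a l -> is_Cseries (fun n => k * a n) (k * l).
Proof.
intros [A1 A2]; split; simpl.
- apply (is_series_minus (K := R_AbsRing) (V := R_NormedModule)); now apply (is_series_scal (K := R_AbsRing) (V := R_NormedModule)).
- apply (is_series_plus (K := R_AbsRing) (V := R_NormedModule)); now apply (is_series_scal (K := R_AbsRing) (V := R_NormedModule)).
Qed.

Lemma is_Cseries_ex (a : nat -> C) (b : nat -> R) :
  (forall n, Cmod (a n) <= b n)%R -> ex_series b ->
  exists l, is_Cseries a l /\ ex_series (fun n => Rabs (Re (a n))) /\ ex_series (fun n => Rabs (Im (a n))).
Proof.
intros H Hb.
assert (H1 : ex_series (fun n => Rabs (Re (a n)))).
{ apply (ex_series_le (K := R_AbsRing) (V := R_CompleteNormedModule)) with b; [|assumption].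
  intros n. change (norm ?x) with (Rabs x). rewrite Rabs_Rabsolu.
  eapply Rle_trans; [apply re_le_Cmod|apply H]. }
assert (H2 : ex_series (fun n => Rabs (Im (a n)))).
{ apply (ex_series_le (K := R_AbsRing) (V := R_CompleteNormedModule)) with b; [|assumption].
  intros n. change (norm ?x) with (Rabs x). rewrite Rabs_Rabsolu.
  eapply Rle_trans; [apply im_le_Cmod|apply H]. }
destruct (ex_series_Rabs _ H1) as [l1 L1]. destruct (ex_series_Rabs _ H2) as [l2 L2].
exists (l1, l2). repeat split; assumption.
Qed.

(** The factor 2 is the price of bounding the real and imaginary parts separately. *)
Lemma is_Cseries_bound (a : nat -> C) (b : nat -> R) l B :
  (forall n, Cmod (a n) <= b n)%R -> is_series b B -> is_Cseries a l -> (Cmod l <= 2 * B)%R.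
Proof.
intros H Hb [H1 H2].
assert (K : forall f (L : R), (forall n, Rabs (f n) <= b n)%R -> is_series f L -> (Rabs L <= B)%R).
{ intros f L Hf HL. rewrite <- (is_series_unique _ _ HL), <- (is_series_unique _ _ Hb).
  assert (E : ex_series (fun n => Rabs (f n))).
  { apply (ex_series_le (K := R_AbsRing) (V := R_CompleteNormedModule)) with b; [|now exists B].
    intros n. change (norm ?x) with (Rabs x). now rewrite Rabs_Rabsolu. }
  eapply Rle_trans; [now apply Series_Rabs|].
  apply Series_le; [|now exists B]. intros n; split; [apply Rabs_pos|apply Hf]. }
eapply Rle_trans; [apply Cmod_le_Re_Im|].
assert (Rabs (Re l) <= B)%R by (apply (K _ _ (fun n => Rle_trans _ _ _ (re_le_Cmod _) (H n)) H1)).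
assert (Rabs (Im l) <= B)%R by (apply (K _ _ (fun n => Rle_trans _ _ _ (im_le_Cmod _) (H n)) H2)).
lra.
Qed.

Lemma Re_sum_n_mult (a b : nat -> C) n m :
  Re (sum_n (fun k => a k * b (m - k)%nat) n) =
  (sum_f_R0 (fun k => Re (a k) * Re (b (m - k)%nat)) n - sum_f_R0 (fun k => Im (a k) * Im (b (m - k)%nat)) n)%R.
Proof.
induction n.
- now rewrite sum_O.
- rewrite sum_Sn. change (plus ?x ?y) with (Cplus x y). rewrite re_plus, IHn, re_mult. simpl. ring.
Qed.

Lemma Im_sum_n_mult (a b : nat -> C) n m :
  Im (sum_n (fun k => a k * b (m - k)%nat) n) =
  (sum_f_R0 (fun k => Re (a k) * Im (b (m - k)%nat)) n + sum_f_R0 (fun k => Im (a k) * Re (b (m - k)%nat)) n)%R.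
Proof.
induction n.
- now rewrite sum_O.
- rewrite sum_Sn. change (plus ?x ?y) with (Cplus x y). rewrite im_plus, IHn, im_mult. simpl. ring.
Qed.

Definition conv (a b : nat -> C) (n : nat) : C := sum_n (fun k => a k * b (n - k)%nat) n.

(** The majorants make both factors absolutely convergent, as required by the four real Cauchy
    products into which the complex one splits. *)
Lemma is_Cseries_mult (a b : nat -> C) (A B : nat -> R) la lb :
  (forall n, Cmod (a n) <= A n)%R -> (forall n, Cmod (b n) <= B n)%R -> ex_series A -> ex_series B ->
  is_Cseries a la -> is_Cseries b lb -> is_Cseries (conv a b) (la * lb).
Proof.
intros HA HB EA EB [a1 a2] [b1 b2].
destruct (is_Cseries_ex a A HA EA) as [_ [_ [A1 A2]]].
destruct (is_Cseries_ex b B HB EB) as [_ [_ [B1 B2]]].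
split.
- eapply is_series_ext; [intros n; symmetry; apply Re_sum_n_mult|].
  rewrite re_mult. apply (is_series_minus (K := R_AbsRing) (V := R_NormedModule)).
  + exact (is_series_mult (fun n => Re (a n)) (fun n => Re (b n)) _ _ a1 b1 A1 B1).
  + exact (is_series_mult (fun n => Im (a n)) (fun n => Im (b n)) _ _ a2 b2 A2 B2).
- eapply is_series_ext; [intros n; symmetry; apply Im_sum_n_mult|].
  rewrite im_mult. apply (is_series_plus (K := R_AbsRing) (V := R_NormedModule)).
  + exact (is_series_mult (fun n => Re (a n)) (fun n => Im (b n)) _ _ a1 b2 A1 B2).
  + exact (is_series_mult (fun n => Im (a n)) (fun n => Re (b n)) _ _ a2 b1 A2 B1).
Qed.

(** * Convergent power series and their products *)

Definition geom_bound (c : nat -> C) (M A : R) : Prop :=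
  (0 <= M)%R /\ (0 < A)%R /\ forall n, (Cmod (c n) <= M * A ^ n)%R.

(** The coefficient bound replaces the radius of convergence: it gives absolute convergence for |u|
    < 1/A, and its constants can be followed explicitly through products, reciprocals and
    derivatives. *)
Definition is_psum (c : nat -> C) (f : C -> C) : Prop :=
  (exists M A, geom_bound c M A) /\
  exists r, (0 < r)%R /\ forall u, (Cmod u < r)%R -> is_Cseries (fun n => c n * u ^ n) (f u).

Lemma geom_bound_weaken c M A M' A' :
  geom_bound c M A -> (M <= M')%R -> (A <= A')%R -> geom_bound c M' A'.
Proof.
intros [H1 [H2 H3]] HM HA. split; [lra|split;[lra|]]. intros n.
eapply Rle_trans; [apply H3|]. apply Rmult_le_compat; try assumption.
- apply pow_le; lra.
- apply pow_incr; lra.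
Qed.

Lemma geom_bound_term c M A u n : geom_bound c M A -> (Cmod (c n * u ^ n) <= M * (A * Cmod u) ^ n)%R.
Proof.
intros [H1 [H2 H3]]. rewrite Cmod_mult, Cmod_pow, Rpow_mult_distr, <- Rmult_assoc.
apply Rmult_le_compat_r; [apply pow_le, Cmod_ge_0|apply H3].
Qed.

Lemma ex_series_geom_scal (M q : R) : (Rabs q < 1)%R -> ex_series (fun n => M * q ^ n)%R.
Proof. intros H. apply (ex_series_scal (K := R_AbsRing) (V := R_NormedModule)). now apply ex_series_geom. Qed.

Lemma small_radius A u : (0 < A)%R -> (Cmod u < / A)%R -> (Rabs (A * Cmod u) < 1)%R.
Proof.
intros HA H. rewrite Rabs_pos_eq; [|apply Rmult_le_pos; [lra|apply Cmod_ge_0]].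
apply Rmult_lt_reg_l with (/ A)%R; [now apply Rinv_0_lt_compat|].
rewrite <- Rmult_assoc, Rinv_l by lra. lra.
Qed.

Lemma geom_bound_ex c M A u : geom_bound c M A -> (Cmod u < / A)%R ->
  exists l, is_Cseries (fun n => c n * u ^ n) l.
Proof.
intros H Hu. destruct (is_Cseries_ex (fun n => c n * u ^ n) (fun n => M * (A * Cmod u) ^ n)%R) as [l [L _]].
- intros n. now apply geom_bound_term.
- apply ex_series_geom_scal, small_radius; [apply H|assumption].
- now exists l.
Qed.

Lemma is_psum_0 c f : is_psum c f -> f 0 = c 0%nat.
Proof.
intros [_ [r [Hr H]]]. assert (H0 := H 0 ltac:(now rewrite Cmod_0)).
apply (is_Cseries_unique _ _ _ H0).
assert (T : is_series (K := C_AbsRing) (V := C_NormedModule) (fun k => scal (pow_n (0 : C) k) (c k)) (c 0%nat))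
  by exact (is_pseries_0 (K := C_AbsRing) (V := C_NormedModule) c).
apply is_series_C_iff in T. revert T. apply is_Cseries_ext. intros n.
change (scal ?x ?y) with (Cmult x y). apply Cmult_comm.
Qed.

Lemma is_psum_ext c f g r : (0 < r)%R -> (forall u, (Cmod u < r)%R -> f u = g u) -> is_psum c f -> is_psum c g.
Proof.
intros Hr E [H0 [r' [Hr' H]]]. split; [assumption|]. exists (Rmin r r').
split; [now apply Rmin_pos|]. intros u Hu. rewrite <- E.
- apply H. eapply Rlt_le_trans; [apply Hu|apply Rmin_r].
- eapply Rlt_le_trans; [apply Hu|apply Rmin_l].
Qed.

Lemma is_psum_plus c d f g : is_psum c f -> is_psum d g -> is_psum (fun n => c n + d n) (fun u => f u + g u).
Proof.
intros [[M [A HA]] [r [Hr Hf]]] [[N [B HB]] [s [Hs Hg]]]. split.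
- exists (M + N)%R, (A + B)%R.
  assert (0 <= M /\ 0 < A /\ 0 <= N /\ 0 < B)%R as [a1 [a2 [b1 b2]]] by (split; [|split; [|split]]; first [apply HA|apply HB]).
  split; [lra|split;[lra|]]. intros n. eapply Rle_trans; [apply Cmod_triangle|].
  rewrite Rmult_plus_distr_r. apply Rplus_le_compat.
  + apply (geom_bound_weaken _ _ _ M (A + B)%R HA); lra.
  + apply (geom_bound_weaken _ _ _ N (A + B)%R HB); lra.
- exists (Rmin r s). split; [now apply Rmin_pos|]. intros u Hu.
  apply is_Cseries_ext with (fun n => c n * u ^ n + d n * u ^ n); [intros; ring|].
  apply is_Cseries_plus; [apply Hf|apply Hg]; (eapply Rlt_le_trans; [apply Hu|]); [apply Rmin_l|apply Rmin_r].
Qed.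

Lemma INR_le_pow2 n : (INR n + 1 <= 2 ^ n)%R.
Proof.
induction n; [simpl; lra|]. rewrite S_INR. simpl. pose proof (pos_INR n). lra.
Qed.

Lemma Cmod_sum_n_le (a : nat -> C) (K : R) n : (forall k, (k <= n)%nat -> Cmod (a k) <= K)%R ->
  (Cmod (sum_n a n) <= (INR n + 1) * K)%R.
Proof.
induction n; intros H.
- rewrite sum_O. simpl. rewrite Rplus_0_l, Rmult_1_l. apply H. lia.
- rewrite sum_Sn. change (plus ?x ?y) with (Cplus x y). eapply Rle_trans; [apply Cmod_triangle|].
  rewrite S_INR. assert (Cmod (sum_n a n) <= (INR n + 1) * K)%R by (apply IHn; intros; apply H; lia).
  assert (Cmod (a (S n)) <= K)%R by (apply H; lia). lra.
Qed.

(** A coefficient is a sum of n + 1 terms of size at most M N A^n; doubling the ratio absorbs n + 1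
    <= 2^n. *)
Lemma conv_geom_bound c d M N A : geom_bound c M A -> geom_bound d N A -> geom_bound (conv c d) (M * N) (2 * A).
Proof.
intros [c1 [c2 c3]] [d1 [_ d3]]. split; [now apply Rmult_le_pos|split;[lra|]]. intros n.
eapply Rle_trans.
- apply Cmod_sum_n_le with (K := (M * N * A ^ n)%R). intros k Hk. rewrite Cmod_mult.
  replace (M * N * A ^ n)%R with (M * A ^ k * (N * A ^ (n - k)))%R.
  + apply Rmult_le_compat; auto using Cmod_ge_0.
  + replace n with (k + (n - k))%nat at 2 by lia. rewrite pow_add. ring.
- rewrite Rpow_mult_distr. replace (M * N * (2 ^ n * A ^ n))%R with (2 ^ n * (M * N * A ^ n))%R by ring.
  apply Rmult_le_compat_r; [|apply INR_le_pow2].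
  apply Rmult_le_pos; [now apply Rmult_le_pos|apply pow_le; lra].
Qed.

Lemma conv_pow c d u n : conv (fun n => c n * u ^ n) (fun n => d n * u ^ n) n = conv c d n * u ^ n.
Proof.
unfold conv. rewrite <- (sum_n_mult_r (K := C_Ring)). apply sum_n_ext_loc. intros k Hk.
change (c k * u ^ k * (d (n - k)%nat * u ^ (n - k)) = c k * d (n - k)%nat * u ^ n).
replace (u ^ n) with (u ^ k * u ^ (n - k)); [ring|].
rewrite <- Cpow_add_r. f_equal. lia.
Qed.

Lemma is_psum_mult c d f g : is_psum c f -> is_psum d g -> is_psum (conv c d) (fun u => f u * g u).
Proof.
intros [[M [A HA]] [r [Hr Hf]]] [[N [B HB]] [s [Hs Hg]]].
pose proof (proj1 (proj2 HA)) as A0. pose proof (proj1 (proj2 HB)) as B0.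
assert (HA' : geom_bound c M (A + B)) by (apply (geom_bound_weaken _ _ _ _ _ HA); lra).
assert (HB' : geom_bound d N (A + B)) by (apply (geom_bound_weaken _ _ _ _ _ HB); lra).
split.
- eexists; eexists; apply (conv_geom_bound _ _ _ _ _ HA' HB').
- exists (Rmin (Rmin r s) (/ (A + B))).
  split; [repeat apply Rmin_pos; try assumption; apply Rinv_0_lt_compat; lra|]. intros u Hu.
  assert (u1 : (Cmod u < r)%R) by (eapply Rlt_le_trans; [apply Hu|eapply Rle_trans; [apply Rmin_l|apply Rmin_l]]).
  assert (u2 : (Cmod u < s)%R) by (eapply Rlt_le_trans; [apply Hu|eapply Rle_trans; [apply Rmin_l|apply Rmin_r]]).
  assert (u3 : (Cmod u < / (A + B))%R) by (eapply Rlt_le_trans; [apply Hu|apply Rmin_r]).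
  eapply is_Cseries_ext; [intros n; apply conv_pow|].
  apply is_Cseries_mult with (fun n => M * ((A + B) * Cmod u) ^ n)%R (fun n => N * ((A + B) * Cmod u) ^ n)%R; auto.
  + intros n. now apply geom_bound_term.
  + intros n. now apply geom_bound_term.
  + apply ex_series_geom_scal, small_radius; lra.
  + apply ex_series_geom_scal, small_radius; lra.
Qed.

(** * Affine functions and reciprocals of power series *)

Lemma sum_n_shift {G : AbelianMonoid} (a : nat -> G) n :
  sum_n a (S n) = plus (a 0%nat) (sum_n (fun k => a (S k)) n).
Proof.
induction n.
- now rewrite sum_Sn, !sum_O.
- rewrite sum_Sn, IHn, (sum_Sn (fun k => a (S k)) n). now rewrite plus_assoc.
Qed.

Lemma is_psum_affine (a b : C) :
  is_psum (fun n => match n with O => a | 1%nat => b | _ => 0 end) (fun u => a + b * u).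
Proof.
split.
- exists (Cmod a + Cmod b)%R, 1%R. pose proof (Cmod_ge_0 a). pose proof (Cmod_ge_0 b).
  split; [lra|split;[lra|]]. intros n. rewrite pow1.
  destruct n as [|[|n]]; try lra. rewrite Cmod_0; lra.
- exists 1%R. split; [lra|]. intros u _. apply is_series_C_iff.
  apply filterlim_ext_loc with (fun _ => a + b * u).
  + exists 1%nat. intros [|n] Hn; [lia|]. clear Hn. induction n.
    * rewrite sum_Sn, sum_O. change (plus ?x ?y) with (Cplus x y). simpl. ring.
    * rewrite sum_Sn, <- IHn. change (plus ?x ?y) with (Cplus x y). ring.
  + apply filterlim_const.
Qed.

(** Each coefficient of 1/f depends on all earlier ones, so the structural recursion carries a whole
    table: [inv_prefix c n] is meaningful at the indices up to n, and level [S m] adds one entry to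
    the table of level m. *)
Fixpoint inv_prefix (c : nat -> C) (n : nat) : nat -> C :=
  match n with
  | O => fun _ => / c 0%nat
  | S m => fun k =>
      if Nat.leb k m then inv_prefix c m k
      else - / c 0%nat * sum_n (fun j => c (S j) * inv_prefix c m (m - j)%nat) m
  end.

Definition inv_seq (c : nat -> C) (n : nat) : C := inv_prefix c n n.

Lemma inv_prefix_eq c n k : (k <= n)%nat -> inv_prefix c n k = inv_seq c k.
Proof.
intros H. induction n.
- replace k with 0%nat by lia. reflexivity.
- destruct (Nat.eq_dec k (S n)) as [->|N]; [reflexivity|].
  simpl. replace (Nat.leb k n) with true by (symmetry; apply Nat.leb_le; lia). apply IHn. lia.
Qed.

Lemma inv_seq_S c n :
  inv_seq c (S n) = - / c 0%nat * sum_n (fun j => c (S j) * inv_seq c (n - j)%nat) n.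
Proof.
unfold inv_seq at 1. cbn [inv_prefix].
replace (Nat.leb (S n) n) with false by (symmetry; apply Nat.leb_gt; lia).
f_equal. apply sum_n_ext_loc. intros j Hj. rewrite inv_prefix_eq by lia. reflexivity.
Qed.

Lemma conv_inv_seq (c : nat -> C) n : c 0%nat <> 0 ->
  conv c (inv_seq c) n = match n with O => RtoC 1 | _ => RtoC 0 end.
Proof.
intros H. unfold conv. destruct n.
- rewrite sum_O. exact (Cinv_r _ H).
- rewrite sum_n_shift. change (plus ?x ?y) with (Cplus x y). simpl Nat.sub.
  rewrite inv_seq_S. set (s := sum_n _ _). now field.
Qed.

Lemma Cmod_sum_n (a : nat -> C) n : (Cmod (sum_n a n) <= sum_n (fun k => Cmod (a k)) n)%R.
Proof.
induction n.
- rewrite !sum_O. lra.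
- rewrite !sum_Sn. change (plus (sum_n a n) ?y) with (Cplus (sum_n a n) y).
  eapply Rle_trans; [apply Cmod_triangle|]. change (plus ?x ?y) with (Rplus x y). lra.
Qed.

Lemma sum_n_le_R (a b : nat -> R) n : (forall k, (k <= n)%nat -> a k <= b k)%R -> (sum_n a n <= sum_n b n)%R.
Proof.
intros H. induction n.
- rewrite !sum_O. now apply H.
- rewrite !sum_Sn. change (plus ?x ?y) with (Rplus x y). apply Rplus_le_compat; [apply IHn; intros; apply H; lia|apply H; lia].
Qed.

(* Bounds the recursion [inv_seq_S] when |c n| <= M A^n and N = M / |c 0|. *)
Lemma inv_majorant (N A : R) n : (0 <= N)%R -> (0 < A)%R ->
  (sum_n (fun j => N * A ^ S j * ((1 + N) * A) ^ (n - j)) n <= ((1 + N) * A) ^ S n)%R.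
Proof.
intros HN HA. induction n.
- rewrite sum_O. simpl. nra.
- rewrite sum_n_shift. change (plus ?x ?y) with (Rplus x y).
  rewrite (sum_n_ext _ (fun k => mult A (N * A ^ S k * ((1 + N) * A) ^ (n - k))%R)).
  + rewrite (sum_n_mult_l (K := R_Ring)). change (mult ?x ?y) with (Rmult x y).
    replace (S n - 0)%nat with (S n) by lia. change (A ^ 1)%R with (A * 1)%R.
    rewrite <- (tech_pow_Rmult _ (S n)).
    assert (A * sum_n (fun j => N * A ^ S j * ((1 + N) * A) ^ (n - j)) n <= A * ((1 + N) * A) ^ S n)%R
      by (apply Rmult_le_compat_l; lra).
    replace ((1 + N) * A * ((1 + N) * A) ^ S n)%R with (N * (A * 1) * ((1 + N) * A) ^ S n + A * ((1 + N) * A) ^ S n)%R by ring.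
    apply Rplus_le_compat_l. assumption.
  + intros k. change (N * A ^ S (S k) * ((1 + N) * A) ^ (n - k) = A * (N * A ^ S k * ((1 + N) * A) ^ (n - k)))%R.
    rewrite <- (tech_pow_Rmult _ (S k)). ring.
Qed.

(** With N = M / |c 0|, the worst case is the reciprocal of 1 - N A t / (1 - A t), which is (1 - A
    t) / (1 - (1 + N) A t); this is the origin of the ratio (1 + N) A. *)
Lemma inv_seq_geom (c : nat -> C) M A : geom_bound c M A -> c 0%nat <> 0 ->
  geom_bound (inv_seq c) (/ Cmod (c 0%nat)) ((1 + M / Cmod (c 0%nat)) * A).
Proof.
intros [H1 [H2 H3]] H0. apply Cmod_gt_0 in H0 as Hm. set (m := Cmod (c 0%nat)) in *.
assert (HN : (0 <= M / m)%R) by (apply Rmult_le_pos; [assumption|left; now apply Rinv_0_lt_compat]).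
assert (Hi : (0 < / m)%R) by now apply Rinv_0_lt_compat.
split; [lra|split]; [apply Rmult_lt_0_compat; lra|].
intros n. induction n as [n IH] using (well_founded_induction Nat.lt_wf_0). destruct n.
- unfold inv_seq; simpl. rewrite Cmod_inv by assumption. fold m. lra.
- rewrite inv_seq_S, Cmod_mult, Cmod_opp, Cmod_inv by assumption. fold m.
  apply Rmult_le_compat_l; [lra|]. eapply Rle_trans; [apply Cmod_sum_n|].
  eapply Rle_trans; [|apply inv_majorant; assumption].
  apply sum_n_le_R. intros k Hk. rewrite Cmod_mult.
  replace (M / m * A ^ S k * ((1 + M / m) * A) ^ (n - k))%R with
    (M * A ^ S k * (/ m * ((1 + M / m) * A) ^ (n - k)))%R by (unfold Rdiv; ring).
  apply Rmult_le_compat; auto using Cmod_ge_0. apply IH. lia.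
Qed.

Definition psum (c : nat -> C) (u : C) : C :=
  (Series (fun n => Re (c n * u ^ n)), Series (fun n => Im (c n * u ^ n))).

Lemma psum_eq c u l : is_Cseries (fun n => c n * u ^ n) l -> psum c u = l.
Proof.
intros [H1 H2]. unfold psum. rewrite (is_series_unique _ _ H1), (is_series_unique _ _ H2).
now destruct l.
Qed.

Lemma is_psum_psum c M A : geom_bound c M A -> is_psum c (psum c).
Proof.
intros H. split; [now exists M, A|]. exists (/ A)%R. split; [apply Rinv_0_lt_compat, H|].
intros u Hu. destruct (geom_bound_ex _ _ _ _ H Hu) as [l Hl]. now rewrite (psum_eq _ _ _ Hl).
Qed.

(** The recursively defined series converges by [inv_seq_geom], and its Cauchy product with [c] is
    the constant 1. This identifies its sum with 1/f and shows at the same time that f does not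
    vanish near 0. *)
Lemma is_psum_inv c (f : C -> C) : is_psum c f -> f 0 <> 0 -> is_psum (inv_seq c) (fun u => / f u).
Proof.
intros Hf H0. assert (c0 : c 0%nat <> 0) by now rewrite <- (is_psum_0 c f).
destruct (proj1 Hf) as [M [A H]].
pose proof (is_psum_psum _ _ _ (inv_seq_geom c M A H c0)) as Hg.
destruct (proj2 (is_psum_mult _ _ _ _ Hf Hg)) as [r [Hr K]].
apply (is_psum_ext _ (psum (inv_seq c)) _ r Hr); [|assumption].
intros u Hu. assert (E : f u * psum (inv_seq c) u = 1).
{ apply (is_Cseries_unique _ _ _ (K u Hu)).
  destruct (is_psum_affine 1 0) as [_ [s [Hs Ha]]].
  replace (RtoC 1) with (1 + 0 * 0) by ring.
  assert (T := Ha 0 ltac:(now rewrite Cmod_0)).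
  revert T. apply is_Cseries_ext. intros n. rewrite conv_inv_seq by assumption.
  destruct n as [|[|n]]; simpl; ring. }
assert (f u <> 0) by (intros Z; rewrite Z, Cmult_0_l in E; now apply C1_nz; rewrite E).
replace (/ f u) with (/ f u * (f u * psum (inv_seq c) u)) by (rewrite E; ring).
now field.
Qed.

(** * Termwise differentiation *)

Definition derive_seq (c : nat -> C) (n : nat) : C := RtoC (INR (S n)) * c (S n).

Lemma derive_seq_geom c M A : geom_bound c M A -> geom_bound (derive_seq c) (2 * (M * A)) (2 * A).
Proof.
intros [H1 [H2 H3]]. split; [nra|split;[lra|]]. intros n. unfold derive_seq.
rewrite Cmod_mult, Cmod_R, Rabs_pos_eq by apply pos_INR.
rewrite Rpow_mult_distr.
assert (INR (S n) <= 2 * 2 ^ n)%R by (pose proof (INR_le_pow2 (S n)); simpl pow in *; lra).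
replace (2 * (M * A) * (2 ^ n * A ^ n))%R with (2 * 2 ^ n * (M * A ^ S n))%R by (simpl; ring).
apply Rmult_le_compat; auto using pos_INR, Cmod_ge_0.
Qed.

Definition dpow (y : C) (n : nat) : C := match n with O => 0 | S m => RtoC (INR n) * y ^ m end.

(** The remainders satisfy R(n+1) = x R(n) + (x - y)^2 [dpow y n], and n^2 + n <= (n + 1)^2 closes
    the induction. The factor rho^2 on the left avoids the exponent n - 2. *)
Lemma pow_taylor_bound (x y : C) (rho : R) n : (0 < rho)%R -> (Cmod x <= rho)%R -> (Cmod y <= rho)%R ->
  (rho ^ 2 * Cmod (x ^ n - y ^ n - (x - y) * dpow y n) <= Cmod (x - y) ^ 2 * INR n ^ 2 * rho ^ n)%R.
Proof.
intros Hr Hx Hy. induction n.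
- simpl. replace (1 - 1 - (x - y) * 0) with (RtoC 0) by ring. rewrite Cmod_0. lra.
- assert (D : (rho * Cmod (dpow y n) <= INR n * rho ^ n)%R).
  { destruct n; cbn [dpow]; [rewrite Cmod_0; simpl; lra|].
    rewrite Cmod_mult, Cmod_R, Cmod_pow, Rabs_pos_eq by apply pos_INR. rewrite <- tech_pow_Rmult.
    assert (Cmod y ^ n <= rho ^ n)%R by (apply pow_incr; split; [apply Cmod_ge_0|assumption]).
    pose proof (pos_INR (S n)).
    apply Rle_trans with (INR (S n) * (rho * Cmod y ^ n))%R; [right; ring|].
    apply Rmult_le_compat_l; [assumption|]. apply Rmult_le_compat_l; lra. }
  assert (E : y * dpow y n = RtoC (INR n) * y ^ n) by (destruct n; cbn [dpow]; [simpl; ring|rewrite Cpow_S; ring]).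
  replace (x ^ S n - y ^ S n - (x - y) * dpow y (S n)) with
    (x * (x ^ n - y ^ n - (x - y) * dpow y n) + (x - y) ^ 2 * dpow y n).
  2:{ cbn [dpow]. rewrite S_INR, RtoC_plus, !Cpow_S.
      transitivity (x * x ^ n - x * y ^ n - (x - y) * (y * dpow y n)); [simpl; ring|]. rewrite E. ring. }
  set (T := x ^ n - y ^ n - (x - y) * dpow y n) in *.
  apply Rle_trans with (rho ^ 2 * (rho * Cmod T + Cmod (x - y) ^ 2 * Cmod (dpow y n)))%R.
  { apply Rmult_le_compat_l; [nra|]. eapply Rle_trans; [apply Cmod_triangle|].
    rewrite !Cmod_mult, Cmod_pow. apply Rplus_le_compat_r, Rmult_le_compat_r; [apply Cmod_ge_0|assumption]. }
  rewrite S_INR. simpl (rho ^ S n)%R.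
  set (d2 := (Cmod (x - y) ^ 2)%R) in *.
  assert (0 <= d2)%R by (apply pow_le, Cmod_ge_0).
  assert (rho * (rho ^ 2 * Cmod T) <= rho * (d2 * INR n ^ 2 * rho ^ n))%R by (apply Rmult_le_compat_l; lra).
  assert (d2 * rho * (rho * Cmod (dpow y n)) <= d2 * rho * (INR n * rho ^ n))%R by (apply Rmult_le_compat_l; [apply Rmult_le_pos; lra|assumption]).
  assert (0 <= d2 * rho * rho ^ n * (INR n + 1))%R.
  { pose proof (pos_INR n). assert (0 <= rho ^ n)%R by (apply pow_le; lra).
    apply Rmult_le_pos; [apply Rmult_le_pos; [apply Rmult_le_pos; lra|assumption]|lra]. }
  replace (rho ^ 2 * (rho * Cmod T + d2 * Cmod (dpow y n)))%R with
    (rho * (rho ^ 2 * Cmod T) + d2 * rho * (rho * Cmod (dpow y n)))%R by ring.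
  replace (d2 * (INR n + 1) ^ 2 * (rho * rho ^ n))%R with
    (rho * (d2 * INR n ^ 2 * rho ^ n) + d2 * rho * (INR n * rho ^ n) + d2 * rho * rho ^ n * (INR n + 1))%R by ring.
  lra.
Qed.

Lemma psum_derive c M A y : geom_bound c M A -> (Cmod y < / (8 * A))%R ->
  is_Cderive (psum c) y (psum (derive_seq c) y).
Proof.
intros H Hy. assert (A0 := proj1 (proj2 H)). assert (M0 := proj1 H).
(* With d = |x - y| and n^2 <= 4^n, the n-th Taylor remainder is at most (M d^2 / rho^2) (4 A
   rho)^n; this choice of [rho] makes 4 A rho = 1/2. *)
set (rho := (/ (8 * A))%R) in *. assert (Hr : (0 < rho)%R) by (apply Rinv_0_lt_compat; lra).
assert (Ar : (A * rho = / 8)%R) by (unfold rho; field; lra).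
assert (HA : forall u, (Cmod u < rho)%R -> (Cmod u < / (2 * A))%R).
{ intros u Hu. eapply Rlt_le_trans; [apply Hu|]. apply Rinv_le_contravar; lra. }
destruct (geom_bound_ex _ _ _ y (derive_seq_geom _ _ _ H) (HA y Hy)) as [g Hg].
assert (HA' : forall u, (Cmod u < rho)%R -> (Cmod u < / A)%R).
{ intros u Hu. eapply Rlt_le_trans; [apply Hu|]. apply Rinv_le_contravar; lra. }
destruct (geom_bound_ex _ _ _ y H (HA' y Hy)) as [fy Hfy].
rewrite (psum_eq _ _ _ Hg).
(* The derived series is reindexed by a zero term at n = 0, so that it can be subtracted term by
   term from the series at x and y. *)
assert (Hg' : is_Cseries (fun n => c n * dpow y n) g).
{ apply is_series_C_iff in Hg. apply is_series_C_iff.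
  assert (E : g + - (c 0%nat * 0) = g) by ring.
  apply (is_series_decr_1 (K := C_AbsRing) (V := C_NormedModule) (fun n => c n * dpow y n)).
  match goal with |- is_series _ ?L => change L with (g + - (c 0%nat * 0)) end.
  rewrite E. revert Hg. apply is_series_ext. intros n.
  change (derive_seq c n * y ^ n = c (S n) * dpow y (S n)). unfold derive_seq. cbn [dpow]. ring. }
apply is_Cderive_iff. intros eps Heps.
(* 4 M / rho^2 is the final constant in front of d^2: a geometric sum equal to 2, times the 2 of
   [is_Cseries_bound]. The added 1 keeps [K] positive when M = 0. *)
set (K := (4 * M / rho ^ 2 + 1)%R).
assert (r2 : (0 < rho ^ 2)%R) by (apply pow_lt; assumption).
assert (HK : (0 < K)%R).
{ unfold K. assert (0 <= 4 * M / rho ^ 2)%R by (apply Rmult_le_pos; [lra|left; now apply Rinv_0_lt_compat]). lra. }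
exists (Rmin (rho - Cmod y) (eps / K)). split; [apply Rmin_pos; [lra|now apply Rdiv_lt_0_compat]|].
intros x Hx.
assert (x1 : (Cmod (x - y) < rho - Cmod y)%R) by (eapply Rlt_le_trans; [apply Hx|apply Rmin_l]).
assert (x2 : (Cmod (x - y) < eps / K)%R) by (eapply Rlt_le_trans; [apply Hx|apply Rmin_r]).
assert (x3 : (Cmod x < rho)%R).
{ pose proof (Cmod_triangle (x - y) y) as T. replace (x - y + y) with x in T by ring. lra. }
destruct (geom_bound_ex _ _ _ x H (HA' x x3)) as [fx Hfx].
rewrite (psum_eq _ _ _ Hfx), (psum_eq _ _ _ Hfy).
assert (HS : is_Cseries (fun n => c n * (x ^ n - y ^ n - (x - y) * dpow y n)) (fx - fy - (x - y) * g)).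
{ replace (fx - fy - (x - y) * g) with (fx + (RtoC (-1) * fy + (-(x - y)) * g)) by (replace (RtoC (-1)) with (- (1)) by (now rewrite <- RtoC_opp); ring).
  eapply is_Cseries_ext; [|apply is_Cseries_plus; [apply Hfx|apply is_Cseries_plus; [apply (is_Cseries_scal (RtoC (-1))), Hfy|apply (is_Cseries_scal (- (x - y))), Hg']]].
  intros n. simpl. replace (RtoC (-1)) with (- (1)) by (now rewrite <- RtoC_opp). ring. }
set (d := Cmod (x - y)) in *. assert (d0 : (0 <= d)%R) by apply Cmod_ge_0.
set (L := (M * d ^ 2 / rho ^ 2)%R).
assert (HB : is_series (fun n => L * (/ 2) ^ n)%R (L * (/ (1 - / 2)))%R).
{ apply (is_series_scal (K := R_AbsRing) (V := R_NormedModule)). apply is_series_geom. rewrite Rabs_pos_eq; lra. }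
assert (K0 : forall n, (Cmod (c n * (x ^ n - y ^ n - (x - y) * dpow y n)) <= L * (/ 2) ^ n)%R).
{ intros n. rewrite Cmod_mult.
  assert (P := pow_taylor_bound x y rho n Hr ltac:(lra) ltac:(lra)). fold d in P.
  set (T := Cmod (x ^ n - y ^ n - (x - y) * dpow y n)) in *.
  assert (P1 : (T <= d ^ 2 * INR n ^ 2 * rho ^ n / rho ^ 2)%R) by (apply Rle_div_r; lra).
  assert (P2 : (INR n ^ 2 <= 4 ^ n)%R).
  { replace 4%R with (2 ^ 2)%R by ring. rewrite <- pow_mult, Nat.mul_comm, pow_mult.
    apply pow_incr. split; [apply pos_INR|]. pose proof (INR_le_pow2 n). lra. }
  apply Rle_trans with (M * A ^ n * (d ^ 2 * 4 ^ n * rho ^ n / rho ^ 2))%R.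
  - apply Rmult_le_compat; auto using Cmod_ge_0; [apply Cmod_ge_0|apply H|].
    eapply Rle_trans; [apply P1|]. apply Rmult_le_compat_r; [left; now apply Rinv_0_lt_compat|].
    apply Rmult_le_compat_r; [apply pow_le; lra|]. apply Rmult_le_compat_l; [apply pow_le; lra|assumption].
  - right. unfold L. replace (/ 2)%R with (4 * (A * rho))%R by (rewrite Ar; field).
    rewrite !Rpow_mult_distr. unfold Rdiv. ring. }
assert (B := is_Cseries_bound _ _ _ _ K0 HB HS). eapply Rle_trans; [apply B|]. unfold L.
replace (2 * (M * d ^ 2 / rho ^ 2 * / (1 - / 2)))%R with (4 * M / rho ^ 2 * d * d)%R by (field; lra).
apply Rmult_le_compat_r; [assumption|].
apply Rle_trans with (K * d)%R; [apply Rmult_le_compat_r; [assumption|unfold K; lra]|].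
apply Rlt_le in x2. apply (Rmult_le_compat_l K) in x2; [|lra].
replace (K * (eps / K))%R with eps in x2 by (field; lra). exact x2.
Qed.

Lemma is_psum_derive c f : is_psum c f -> exists g, is_psum (derive_seq c) g /\
  exists r, (0 < r)%R /\ forall u, (Cmod u < r)%R -> is_Cderive f u (g u).
Proof.
intros [[M [A H]] [r [Hr Hf]]]. exists (psum (derive_seq c)). split.
- eapply is_psum_psum, derive_seq_geom, H.
- assert (HA := proj1 (proj2 H)).
  exists (Rmin (r / 2) (/ (8 * A))). split; [apply Rmin_pos; [lra|apply Rinv_0_lt_compat; lra]|].
  intros u Hu. apply is_Cderive_ext_loc with (psum c) (r / 2)%R; [lra| |].
  + intros w Hw. apply psum_eq, Hf. pose proof (Cmod_triangle (w - u) u) as T. replace (w - u + u) with w in T by ring.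
    assert (Cmod u < r / 2)%R by (eapply Rlt_le_trans; [apply Hu|apply Rmin_l]). lra.
  + eapply psum_derive; [apply H|]. eapply Rlt_le_trans; [apply Hu|apply Rmin_r].
Qed.

Lemma is_pseries_C_iff c u l : is_pseries (K := C_AbsRing) (V := C_NormedModule) c u l <->
  is_Cseries (fun n => c n * u ^ n) l.
Proof.
unfold is_pseries. rewrite is_series_C_iff.
split; apply is_Cseries_ext; intros n; change (scal ?x ?y) with (Cmult x y); apply Cmult_comm.
Qed.

(** * Analytic germs, punctured neighbourhoods and pole orders *)

Definition analytic (f : C -> C) : Prop := exists c, is_psum c f.

Definition punct (P : C -> Prop) : Prop :=
  exists r, (0 < r)%R /\ forall u : C, u <> 0 -> (Cmod u < r)%R -> P u.

Lemma punct_and P Q : punct P -> punct Q -> punct (fun u => P u /\ Q u).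
Proof.
intros [r [Hr HP]] [s [Hs HQ]]. exists (Rmin r s). split; [now apply Rmin_pos|].
intros u H0 Hu. split; [apply HP|apply HQ]; try assumption; (eapply Rlt_le_trans; [apply Hu|]); [apply Rmin_l|apply Rmin_r].
Qed.

Lemma punct_imp (P Q : C -> Prop) : (forall u : C, u <> 0 -> P u -> Q u) -> punct P -> punct Q.
Proof. intros H [r [Hr HP]]. exists r. split; [assumption|]. intros u H0 Hu. apply H; auto. Qed.

Lemma near_punct p P : near p P <-> punct (fun u => P (zparam p u)).
Proof. apply locally'_C0_iff. Qed.

(** A punctured disc is open, so two functions that agree on it agree on a full disc around each of
    its points; the radius avoids both 0 and the outer circle. *)
Lemma punct_Cderive_ext f g : punct (fun u => f u = g u) ->
  punct (fun u => forall l, is_Cderive f u l -> is_Cderive g u l).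
Proof.
intros [r [Hr E]]. exists r. split; [assumption|]. intros u H0 Hu l.
apply is_Cderive_ext_loc with (Rmin (Cmod u) (r - Cmod u)).
- apply Rmin_pos; [now apply Cmod_gt_0|lra].
- intros w Hw.
  assert (w1 : (Cmod (w - u) < Cmod u)%R) by (eapply Rlt_le_trans; [apply Hw|apply Rmin_l]).
  assert (w2 : (Cmod (w - u) < r - Cmod u)%R) by (eapply Rlt_le_trans; [apply Hw|apply Rmin_r]).
  apply E.
  + intros ->. replace (0 - u) with (- u) in w1 by ring. rewrite Cmod_opp in w1. lra.
  + pose proof (Cmod_triangle (w - u) u) as T. replace (w - u + u) with w in T by ring. lra.
Qed.

Lemma analytic_affine a b : analytic (fun u => a + b * u).
Proof. eexists; apply is_psum_affine. Qed.

Lemma analytic_ext f g : (forall u, f u = g u) -> analytic f -> analytic g.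
Proof. intros E [c H]. exists c. apply (is_psum_ext c f g 1 Rlt_0_1); auto. Qed.

Lemma analytic_const a : analytic (fun _ => a).
Proof. apply (analytic_ext (fun u => a + 0 * u)); [intros; ring|apply analytic_affine]. Qed.

Lemma analytic_plus f g : analytic f -> analytic g -> analytic (fun u => f u + g u).
Proof. intros [c Hc] [d Hd]. eexists. apply (is_psum_plus _ _ _ _ Hc Hd). Qed.

Lemma analytic_mult f g : analytic f -> analytic g -> analytic (fun u => f u * g u).
Proof. intros [c Hc] [d Hd]. eexists. apply (is_psum_mult _ _ _ _ Hc Hd). Qed.

Lemma analytic_inv (f : C -> C) : analytic f -> f 0 <> 0 -> analytic (fun u => / f u).
Proof. intros [c Hc] H. eexists. apply (is_psum_inv _ _ Hc H). Qed.

Lemma analytic_id : analytic (fun u => u).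
Proof. apply (analytic_ext (fun u => 0 + 1 * u)); [intros; ring|apply analytic_affine]. Qed.

Lemma analytic_derive f : analytic f -> exists g, analytic g /\
  exists r, (0 < r)%R /\ forall u, (Cmod u < r)%R -> is_Cderive f u (g u).
Proof. intros [c H]. destruct (is_psum_derive _ _ H) as [g [Hg K]]. exists g. split; [now exists (derive_seq c)|assumption]. Qed.

(** Differentiability at 0 gives |f u - f 0| <= (1 + |f' 0|) |u|, which stays below |f 0| for small
    u. *)
Lemma analytic_neq_0 (f : C -> C) : analytic f -> f 0 <> 0 -> punct (fun u => f u <> 0).
Proof.
intros H H0. destruct (analytic_derive _ H) as [g [_ [r [Hr D]]]].
assert (D0 := D 0 ltac:(now rewrite Cmod_0)). rewrite is_Cderive_iff in D0.
destruct (D0 1%R Rlt_0_1) as [d [Hd Hf]].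
assert (m0 := proj1 (Cmod_gt_0 _) H0).
set (K := (1 + Cmod (g 0))%R). assert (HK : (0 < K)%R) by (unfold K; pose proof (Cmod_ge_0 (g 0)); lra).
exists (Rmin d (Cmod (f 0) / K)). split; [apply Rmin_pos; [assumption|now apply Rdiv_lt_0_compat]|].
intros u _ Hu Z.
assert (u1 : (Cmod u < d)%R) by (eapply Rlt_le_trans; [apply Hu|apply Rmin_l]).
assert (u2 : (Cmod u < Cmod (f 0) / K)%R) by (eapply Rlt_le_trans; [apply Hu|apply Rmin_r]).
specialize (Hf u). replace (u - 0) with u in Hf by ring. specialize (Hf u1). rewrite Z in Hf.
pose proof (Cmod_triangle (0 - f 0 - u * g 0) (u * g 0)) as T.
replace (0 - f 0 - u * g 0 + u * g 0) with (- f 0) in T by ring. rewrite Cmod_opp, Cmod_mult in T.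
apply (Rmult_lt_compat_l K) in u2; [|assumption].
replace (K * (Cmod (f 0%R) / K))%R with (Cmod (f 0)) in u2 by (field; lra).
unfold K in u2. lra.
Qed.

(** Abel's argument: the terms at [u0] tend to 0, hence are bounded, so the coefficients grow at
    most like |u0|^(-n). *)
Lemma is_Cseries_geom_bound c (u0 : C) l : u0 <> 0 -> is_Cseries (fun n => c n * u0 ^ n) l ->
  exists M A, geom_bound c M A.
Proof.
intros H0 [H1 H2].
destruct (filterlim_bounded (K := R_AbsRing) (V := R_NormedModule) (fun n => Re (c n * u0 ^ n))) as [M1 B1].
{ exists 0%R. apply ex_series_lim_0. now exists (Re l). }
destruct (filterlim_bounded (K := R_AbsRing) (V := R_NormedModule) (fun n => Im (c n * u0 ^ n))) as [M2 B2].
{ exists 0%R. apply ex_series_lim_0. now exists (Im l). }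
assert (m0 := proj1 (Cmod_gt_0 _) H0).
assert (B : forall n, (Cmod (c n * u0 ^ n) <= M1 + M2)%R).
{ intros n. eapply Rle_trans; [apply Cmod_le_Re_Im|].
  apply Rplus_le_compat; [apply B1|apply B2]. }
exists (M1 + M2)%R, (/ Cmod u0)%R. split; [|split].
- eapply Rle_trans; [|apply (B 0%nat)]. apply Cmod_ge_0.
- now apply Rinv_0_lt_compat.
- intros n. rewrite pow_inv. apply Rle_div_r; [apply pow_lt; assumption|].
  rewrite <- Cmod_pow, <- Cmod_mult. apply B.
Qed.

Lemma laurent_psum N c f : laurent N c f -> exists g, is_psum c g /\ punct (fun u => u ^ N * f u = g u).
Proof.
intros H. apply locally'_C0_iff in H. destruct H as [r [Hr H]].
assert (K : forall u : C, u <> 0 -> (Cmod u < r)%R -> is_Cseries (fun n => c n * u ^ n) (u ^ N * f u))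
  by (intros; apply is_pseries_C_iff; auto).
assert (E : Cmod (RtoC (r / 2)) = (r / 2)%R) by (rewrite Cmod_R; apply Rabs_pos_eq; lra).
assert (Hu0 : RtoC (r / 2) <> 0) by (apply Cmod_gt_0; lra).
destruct (is_Cseries_geom_bound c (RtoC (r / 2)) _ Hu0 (K _ Hu0 ltac:(lra))) as [M [A G]].
exists (psum c). split; [now apply is_psum_psum with M A|].
exists r. split; [assumption|]. intros u H0 Hu. symmetry. apply psum_eq. auto.
Qed.

Lemma psum_laurent N c f g : is_psum c g -> punct (fun u => u ^ N * f u = g u) -> laurent N c f.
Proof.
intros [_ [r [Hr H]]] [s [Hs E]]. apply locally'_C0_iff.
exists (Rmin r s). split; [now apply Rmin_pos|]. intros u H0 Hu.
rewrite E; [|assumption|eapply Rlt_le_trans; [apply Hu|apply Rmin_r]].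
apply is_pseries_C_iff, H. eapply Rlt_le_trans; [apply Hu|apply Rmin_l].
Qed.

Lemma pole_order_le_iff N f : pole_order_le N f <->
  exists g, analytic g /\ punct (fun u => u ^ N * f u = g u).
Proof.
split.
- intros [c H]. destruct (laurent_psum _ _ _ H) as [g [Hg E]]. exists g. split; [now exists c|assumption].
- intros [g [[c Hc] E]]. exists c. now apply psum_laurent with g.
Qed.

Lemma is_Cderive_pow (n : nat) (u : C) : is_Cderive (fun v => v ^ n) u (dpow u n).
Proof.
induction n.
- exact (is_Cderive_const 1 u).
- replace (dpow u (S n)) with (1 * u ^ n + u * dpow u n).
  + apply (is_Cderive_mult (fun v => v) (fun v => v ^ n) u); [apply is_Cderive_id|assumption].
  + cbn [dpow]. rewrite S_INR, RtoC_plus. destruct n; cbn [dpow]; [simpl; ring|rewrite Cpow_S; ring].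
Qed.

Lemma dpow_mult (u : C) n : u * dpow u n = RtoC (INR n) * u ^ n.
Proof. destruct n; cbn [dpow]; [simpl; ring|rewrite Cpow_S; ring]. Qed.

Lemma pole_order_derive N f : pole_order_le N f -> exists df,
  punct (fun u => is_Cderive f u (df u)) /\ pole_order_le (S N) df.
Proof.
intros H. apply pole_order_le_iff in H. destruct H as [g [Hg E]].
destruct (analytic_derive _ Hg) as [dg [Hdg [r [Hr D]]]].
exists (fun u => dg u * / u ^ N + g u * (dpow u N * - / (u ^ N * u ^ N))). split.
- assert (E' : punct (fun u => g u * / u ^ N = f u)).
  { revert E. apply punct_imp. intros u H0 <-. field. now apply Cpow_nz. }
  apply punct_Cderive_ext in E'.
  assert (D' : punct (fun u => is_Cderive g u (dg u))) by (exists r; split; auto).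
  generalize (punct_and _ _ E' D'). apply punct_imp. intros u H0 [A B]. apply A.
  apply (is_Cderive_mult g (fun v => / v ^ N)); [assumption|].
  apply (is_Cderive_comp (fun v => / v) (fun v => v ^ N)); [now apply is_Cderive_inv, Cpow_nz|apply is_Cderive_pow].
(* For f = g / u^N one has u^(N+1) f' = u g' - N g. *)
- apply pole_order_le_iff. exists (fun u => u * dg u + (- RtoC (INR N)) * g u). split.
  + apply analytic_plus; apply analytic_mult; auto using analytic_id, analytic_const.
  + exists 1%R. split; [lra|]. intros u H0 _.
    assert (P : u ^ N <> 0) by now apply Cpow_nz.
    rewrite Cpow_S. transitivity (u * dg u - g u * (u * dpow u N) * / u ^ N); [now field|].
    rewrite dpow_mult. now field.
Qed.

(** * The connection *)

(** This is phi'' / phi' for the affine coordinate with d phi = dz / (3 z^(2/3) (1 - z)), that is dy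
    / (1 - y^3) written in z = y^3; its single-valuedness is what lets the flat structure
    descend. *)
Definition conn_coef (z : C) : C := - (2 / 3) / z - 1 / (z - 1).

(** [C_derive] is total, so this is an operator on all functions. Its value is meaningful where s is
    differentiable; for a meromorphic s this holds near every point, by
    [meromorphic_field_derive]. *)
Definition conn (s : C -> C) (z : C) : C := C_derive s z + conn_coef z * s z.

Definition ddzparam (p : CP1) (u : C) : C :=
  match p with Some _ => 0 | None => 2 / (u * u * u) end.

Lemma dzparam_neq_0 p (u : C) : u <> 0 -> dzparam p u <> 0.
Proof.
intros H. destruct p; [apply C1_nz|]. simpl. intros Z.
apply C1_nz. transitivity (- (u * u) * - / (u * u)); [now field|]. rewrite Z. ring.
Qed.

Lemma is_Cderive_dzparam p (u : C) : u <> 0 -> is_Cderive (dzparam p) u (ddzparam p u).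
Proof.
intros H. destruct p; simpl; [apply is_Cderive_const|].
replace (2 / (u * u * u)) with (0 * / (u * u) + (- (1)) * ((1 * u + u * 1) * - / (u * u * (u * u)))).
2:{ now field. }
apply is_Cderive_ext_loc with (fun v => - (1) * / (v * v)) 1%R; [lra|intros w _; unfold dzparam; ring|].
apply (is_Cderive_mult (fun _ => - (1)) (fun v => / (v * v))); [apply is_Cderive_const|].
apply (is_Cderive_comp (fun v => / v) (fun v => v * v)).
- apply is_Cderive_inv. now apply Cmult_neq_0.
- apply (is_Cderive_mult (fun v => v) (fun v => v)); apply is_Cderive_id.
Qed.

Lemma zparam_chain p F (u l : C) : u <> 0 -> is_Cderive (fun v => F (zparam p v)) u l ->
  is_Cderive F (zparam p u) (l / dzparam p u).
Proof.
intros H0 H. destruct p as [a|]; simpl.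
- apply is_Cderive_ext_loc with (fun z => F (a + (- a + z))) 1%R; [lra|intros; f_equal; ring|].
  replace (l / 1) with ((0 + 1) * l) by field.
  apply (is_Cderive_comp (fun v => F (a + v)) (fun z => - a + z)).
  + now replace (- a + (a + u)) with u by ring.
  + apply is_Cderive_plus; [apply is_Cderive_const|apply is_Cderive_id].
- apply is_Cderive_ext_loc with (fun z => F (/ / z)) (Cmod (/ u)).
  + apply Cmod_gt_0. intros Z. apply C1_nz. rewrite <- (Cinv_r u H0), Z. ring.
  + intros w Hw. f_equal. field. intros ->. replace (0 - / u) with (- / u) in Hw by ring.
    rewrite Cmod_opp in Hw. lra.
  + replace (l / - / (u * u)) with ((- / (/ u * / u)) * l) by (now field).
    apply (is_Cderive_comp (fun v => F (/ v)) (fun z => / z)).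
    * now replace (/ / u) with u by now field.
    * apply is_Cderive_inv. intros Z. apply C1_nz. rewrite <- (Cinv_r u H0), Z. ring.
Qed.

(* [fun v => s (zparam p v) / dzparam p v] is the component of the vector field s on d/du. *)
Lemma conn_coord p s (u d : C) : u <> 0 ->
  is_Cderive (fun v => s (zparam p v) / dzparam p v) u d ->
  conn s (zparam p u) =
  d + (ddzparam p u / dzparam p u + conn_coef (zparam p u) * dzparam p u) * (s (zparam p u) / dzparam p u).
Proof.
intros H0 H. assert (Hz := dzparam_neq_0 p u H0).
assert (K : is_Cderive (fun v => s (zparam p v)) u (d * dzparam p u + s (zparam p u) / dzparam p u * ddzparam p u)).
{ apply is_Cderive_ext_loc with (fun v => s (zparam p v) / dzparam p v * dzparam p v) (Cmod u); [now apply Cmod_gt_0| |].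
  - intros w Hw. field. apply dzparam_neq_0. intros ->. replace (0 - u) with (- u) in Hw by ring.
    rewrite Cmod_opp in Hw. lra.
  - apply (is_Cderive_mult (fun v => s (zparam p v) / dzparam p v)); [assumption|now apply is_Cderive_dzparam]. }
apply zparam_chain in K; [|assumption]. apply is_C_derive_unique in K.
unfold conn. rewrite K. now field.
Qed.

Lemma RtoC_m1 : RtoC (-1) = - (1).
Proof. apply injective_projections; simpl; ring. Qed.

(** The expression is the connection form of d/du, with the chart term z'' / z' of the
    transformation rule; h(0) is the residue: - 2/3 at 0, - 1 at 1, - 1/3 at infinity, 0 elsewhere.
    At infinity the chart term gives - 2 and the two finite poles give 2/3 and 1 / (1 - u). *)
Lemma conn_simple_pole p : exists h, analytic h /\
  punct (fun u => ddzparam p u / dzparam p u + conn_coef (zparam p u) * dzparam p u = h u / u).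
Proof.
unfold conn_coef.
assert (I : forall a : C, a <> 0 -> analytic (fun u => / (a + 1 * u))).
{ intros a Ha. apply (analytic_inv (fun u => a + 1 * u)); [apply analytic_affine|].
  replace (a + 1 * 0) with a by ring. assumption. }
assert (J : forall a k : C, a <> 0 -> analytic (fun u => k * (u * / (a + 1 * u)))).
{ intros a k Ha. apply (analytic_mult (fun _ => k) (fun u => u * / (a + 1 * u))); [apply analytic_const|].
  apply (analytic_mult (fun u => u) (fun u => / (a + 1 * u))); [apply analytic_id|now apply I]. }
assert (S : forall a : C, a <> 0 -> punct (fun u => a + u <> 0)).
{ intros a Ha. exists (Cmod a). split; [now apply Cmod_gt_0|]. intros u _ Hu Z.
  replace a with (- u) in Hu by (rewrite <- (Cplus_0_r (- u)), <- Z; ring). rewrite Cmod_opp in Hu. lra. }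
assert (N1 : RtoC 1 <> 0) by apply C1_nz.
assert (Nm1 : RtoC (-1) <> 0) by (intros [=]; lra).
assert (N3 : RtoC 3 <> 0) by (intros [=]; lra).
destruct p as [a|]; simpl.
- destruct (Ceq_dec a 0) as [->|Ha]; [|destruct (Ceq_dec a 1) as [->|Ha1]].
  + exists (fun u => - (2 / 3) + (- (1)) * (u * / (RtoC (-1) + 1 * u))). split.
    * apply (analytic_plus (fun _ => _) (fun u => _)); [apply analytic_const|now apply J].
    * generalize (S _ Nm1). apply punct_imp. intros u H0 H1.
      rewrite RtoC_m1 in *. assert (H2 : u - 1 <> 0) by (intros Z; apply H1; rewrite <- Z; ring).
      replace (- (1) + 1 * u) with (u - 1) by ring. replace (0 + u) with u by ring.
      field. auto.
  + exists (fun u => - (1) + (- (2 / 3)) * (u * / (RtoC 1 + 1 * u))). split.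
    * apply (analytic_plus (fun _ => _) (fun u => _)); [apply analytic_const|now apply J].
    * generalize (S _ N1). apply punct_imp. intros u H0 H1.
      replace (1 * u) with u by ring. replace (1 + u - 1) with u by ring. field. auto.
  + assert (Ha1' : a - 1 <> 0) by now apply Cminus_eq_contra.
    exists (fun u => - (2 / 3) * (u * / (a + 1 * u)) + (- (1)) * (u * / ((a - 1) + 1 * u))). split.
    * apply (analytic_plus (fun u => _) (fun u => _)); now apply J.
    * generalize (punct_and _ _ (S _ Ha) (S _ Ha1')). apply punct_imp. intros u H0 [H1 H2].
      replace (1 * u) with u by ring. replace (a - 1 + u) with (a + u - 1) in * by ring.
      field. auto.
- exists (fun u => - (4 / 3) + / (1 + (- (1)) * u)). split.
  + apply (analytic_plus (fun _ => _) (fun u => _)); [apply analytic_const|].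
    apply (analytic_inv (fun u => 1 + (- (1)) * u)); [apply analytic_affine|].
    replace (1 + - (1) * 0) with (RtoC 1) by ring. assumption.
  + generalize (S _ Nm1). apply punct_imp. intros u H0 H1. rewrite RtoC_m1 in H1.
    assert (H2 : 1 - u <> 0) by (intros Z; apply H1; transitivity (- (1 - u)); [ring|rewrite Z; ring]).
    replace (1 + - (1) * u) with (1 - u) by ring.
    replace (/ u - 1) with ((1 - u) / u) by (now field). field. auto.
Qed.

(** * The operator is a Fuchsian meromorphic connection *)

Definition comp_coord (p : CP1) (s : C -> C) (u : C) : C := s (zparam p u) / dzparam p u.

Lemma meromorphic_field_derive p s : meromorphic_field p s -> exists N df,
  pole_order_le N (comp_coord p s) /\ pole_order_le (S N) df /\
  punct (fun u => is_Cderive (comp_coord p s) u (df u)).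
Proof.
intros [N H]. destruct (pole_order_derive _ _ H) as [df [H1 H2]]. exists N, df. auto.
Qed.

Lemma conn_local p s1 s2 : meromorphic_field p s1 -> meromorphic_field p s2 ->
  germ_eq p s1 s2 -> germ_eq p (conn s1) (conn s2).
Proof.
intros H1 _ E. apply near_punct in E. apply near_punct.
destruct (meromorphic_field_derive _ _ H1) as [N [df [_ [_ D]]]].
assert (E' : punct (fun u => comp_coord p s1 u = comp_coord p s2 u)).
{ revert E. apply punct_imp. unfold comp_coord. now intros u _ ->. }
generalize (punct_and _ _ (punct_and _ _ D (punct_Cderive_ext _ _ E')) E). apply punct_imp.
intros u H0 [[A B] Eu]. rewrite (conn_coord p s1 u _ H0 A), (conn_coord p s2 u _ H0 (B _ A)). now rewrite Eu.
Qed.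

Lemma conn_meromorphic p s : meromorphic_field p s -> meromorphic_field_form p (conn s).
Proof.
intros H. destruct (meromorphic_field_derive _ _ H) as [N [df [H1 [H2 D]]]].
exists (S N). destruct (conn_simple_pole p) as [h [Hh Eh]].
apply pole_order_le_iff in H1. apply pole_order_le_iff in H2.
destruct H1 as [g1 [G1 E1]]. destruct H2 as [g2 [G2 E2]].
apply pole_order_le_iff. exists (fun u => g2 u + h u * g1 u). split.
- apply (analytic_plus g2); [assumption|now apply analytic_mult].
- generalize (punct_and _ _ (punct_and _ _ D Eh) (punct_and _ _ E1 E2)). apply punct_imp.
  intros u H0 [[A B] [C1 C2]]. rewrite (conn_coord p s u _ H0 A), B. fold (comp_coord p s u).
  rewrite <- C1, <- C2, Cpow_S. now field.
Qed.

Lemma conn_add p s1 s2 : meromorphic_field p s1 -> meromorphic_field p s2 ->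
  germ_eq p (conn (fun z => s1 z + s2 z)) (fun z => conn s1 z + conn s2 z).
Proof.
intros H1 H2. apply near_punct.
destruct (meromorphic_field_derive _ _ H1) as [N1 [d1 [_ [_ D1]]]].
destruct (meromorphic_field_derive _ _ H2) as [N2 [d2 [_ [_ D2]]]].
generalize (punct_and _ _ D1 D2). apply punct_imp. intros u H0 [A B].
rewrite (conn_coord p s1 u _ H0 A), (conn_coord p s2 u _ H0 B).
rewrite (conn_coord p _ u (d1 u + d2 u) H0).
- assert (dzparam p u <> 0) by now apply dzparam_neq_0. now field.
- apply is_Cderive_ext_loc with (fun v => comp_coord p s1 v + comp_coord p s2 v) 1%R; [lra| |now apply is_Cderive_plus].
  intros w _. unfold comp_coord, Cdiv. ring.
Qed.

Lemma conn_leibniz p F s : meromorphic_fun p F -> meromorphic_field p s ->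
  germ_eq p (conn (fun z => F z * s z)) (fun z => s z * C_derive F z + F z * conn s z).
Proof.
intros [M HF] H. apply near_punct.
destruct (meromorphic_field_derive _ _ H) as [N [ds [_ [_ D]]]].
destruct (pole_order_derive _ _ HF) as [dF [DF _]].
generalize (punct_and _ _ D DF). apply punct_imp. intros u H0 [A B].
rewrite (conn_coord p s u _ H0 A).
rewrite (is_C_derive_unique _ _ _ (zparam_chain p F u _ H0 B)).
rewrite (conn_coord p _ u (dF u * comp_coord p s u + F (zparam p u) * ds u) H0).
- unfold comp_coord. assert (dzparam p u <> 0) by now apply dzparam_neq_0. now field.
- apply is_Cderive_ext_loc with (fun v => F (zparam p v) * comp_coord p s v) 1%R; [lra| |now apply (is_Cderive_mult (fun v => F (zparam p v)))].
  intros w _. unfold comp_coord, Cdiv. ring.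
Qed.

Lemma conn_scale p (k : C) s : meromorphic_field p s ->
  germ_eq p (conn (fun z => k * s z)) (fun z => k * conn s z).
Proof.
intros H. apply near_punct.
destruct (meromorphic_field_derive _ _ H) as [N [ds [_ [_ D]]]].
revert D. apply punct_imp. intros u H0 A.
rewrite (conn_coord p s u _ H0 A). rewrite (conn_coord p _ u (0 * comp_coord p s u + k * ds u) H0).
- assert (dzparam p u <> 0) by now apply dzparam_neq_0. now field.
- apply is_Cderive_ext_loc with (fun v => k * comp_coord p s v) 1%R; [lra| |].
  + intros w _. unfold comp_coord, Cdiv. ring.
  + apply (is_Cderive_mult (fun _ => k)); [apply is_Cderive_const|assumption].
Qed.

Definition connection : meromorphic_connection :=
  {| nabla := conn; nabla_local := conn_local; nabla_meromorphic := conn_meromorphic;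
     nabla_add := conn_add; nabla_scale := conn_scale; nabla_leibniz := conn_leibniz |}.

(** If g is zeta as a function of u, then d/dzeta has component 1/g' on d/du, and its form is (h / u
    - g'' / g') du. As g'(0) is nonzero, the second term is holomorphic. *)
Lemma Fuchsian_connection : Fuchsian connection.
Proof.
intros p zeta eta [c [Hc c1]] H.
destruct (laurent_psum _ _ _ Hc) as [g [Hg E]].
destruct (is_psum_derive _ _ Hg) as [dg [Hdg [r [Hr D]]]].
assert (D' : punct (fun u => is_Cderive g u (dg u))) by (exists r; split; auto).
assert (dg0 : dg 0 <> 0).
{ rewrite (is_psum_0 _ _ Hdg). unfold derive_seq. apply Cmult_neq_0; [intros [=]; lra|assumption]. }
assert (Adg : analytic dg) by (now exists (derive_seq c)).
destruct (analytic_derive _ Adg) as [ddg [Addg [r2 [Hr2 D2]]]].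
assert (D2' : punct (fun u => is_Cderive dg u (ddg u))) by (exists r2; split; auto).
destruct (conn_simple_pole p) as [h [Hh Eh]].
assert (E' : punct (fun u => g u = zeta (zparam p u))).
{ revert E. apply punct_imp. intros u _ <-. simpl. ring. }
assert (Z : punct (fun u => comp_coord p (coordinate_field zeta) u = / dg u)).
{ generalize (punct_and _ _ (punct_and _ _ D' (punct_Cderive_ext _ _ E')) (analytic_neq_0 _ Adg dg0)).
  apply punct_imp. intros u H0 [[A B] N]. unfold comp_coord, coordinate_field.
  rewrite (is_C_derive_unique _ _ _ (zparam_chain p zeta u _ H0 (B _ A))).
  assert (dzparam p u <> 0) by now apply dzparam_neq_0. now field. }
assert (Z' : punct (fun u => / dg u = comp_coord p (coordinate_field zeta) u)).
{ revert Z. apply punct_imp. now intros. }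
apply near_punct in H. apply pole_order_le_iff.
exists (fun u => (- (1)) * (u * (ddg u * / dg u)) + h u). split.
- apply (analytic_plus (fun u => (- (1)) * (u * (ddg u * / dg u)))); [|assumption].
  apply (analytic_mult (fun _ => - (1))); [apply analytic_const|].
  apply (analytic_mult (fun u => u)); [apply analytic_id|].
  apply (analytic_mult ddg); [assumption|now apply analytic_inv].
- generalize (punct_and _ _ (punct_and _ _ (punct_and _ _ D2' (punct_Cderive_ext _ _ Z')) (punct_and _ _ Z Eh))
    (punct_and _ _ H (analytic_neq_0 _ Adg dg0))).
  apply punct_imp. intros u H0 [[[A B] [Zu Ehu]] [Hu N]].
  assert (Nz : dzparam p u <> 0) by now apply dzparam_neq_0.
  assert (K : is_Cderive (comp_coord p (coordinate_field zeta)) u (ddg u * - / (dg u * dg u))).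
  { apply B. apply (is_Cderive_comp (fun v => / v) dg); [now apply is_Cderive_inv|assumption]. }
  simpl in Hu. rewrite (conn_coord p _ u _ H0 K), Ehu in Hu. fold (comp_coord p (coordinate_field zeta) u) in Hu.
  assert (S : coordinate_field zeta (zparam p u) = / dg u * dzparam p u).
  { rewrite <- Zu. unfold comp_coord. now field. }
  rewrite Zu, S in Hu. rewrite Cpow_1_r.
  transitivity (u * dg u * (/ dg u * dzparam p u * eta (zparam p u))); [now field|].
  rewrite <- Hu. field. auto.
Qed.

(** d/dz has constant component in the coordinate z, so its form is [conn_coef] itself. Only finite
    points are treated, because the curve never meets infinity. *)
Lemma connection_regular (z : C) : z <> 0 -> z <> 1 -> exists e,
  regular_expansion connection (Some z) e /\ e 0%nat = conn_coef z.
Proof.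
intros H0 H1. assert (H1' : z - 1 <> 0) by now apply Cminus_eq_contra.
assert (D : forall w, C_derive (fun z => z) w = 1) by (intros; apply is_C_derive_unique, is_Cderive_id).
assert (A : analytic (fun u => conn_coef (z + u))).
{ apply (analytic_ext (fun u => - (2 / 3) * / (z + 1 * u) + - (1) * / ((z - 1) + 1 * u))).
  { intros u. unfold conn_coef. replace (z + 1 * u) with (z + u) by ring. replace (z - 1 + 1 * u) with (z + u - 1) by ring.
    unfold Cdiv. ring. }
  apply (analytic_plus (fun u => _) (fun u => _)).
  - apply (analytic_mult (fun _ => _)); [apply analytic_const|].
    apply (analytic_inv (fun u => z + 1 * u)); [apply analytic_affine|]. now replace (z + 1 * 0) with z by ring.
  - apply (analytic_mult (fun _ => _)); [apply analytic_const|].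
    apply (analytic_inv (fun u => z - 1 + 1 * u)); [apply analytic_affine|]. now replace (z - 1 + 1 * 0) with (z - 1) by ring. }
destruct A as [e He]. exists e. split.
- exists conn_coef. split.
  + apply near_punct. exists 1%R. split; [lra|]. intros u _ _. simpl. unfold conn.
    assert (K : is_Cderive (coordinate_field (fun z => z)) (z + u) 0).
    { apply is_Cderive_ext_loc with (fun _ => / 1) 1%R; [lra| |apply is_Cderive_const].
      intros w _. unfold coordinate_field. now rewrite D. }
    rewrite (is_C_derive_unique _ _ _ K). ring.
  + apply psum_laurent with (fun u => conn_coef (z + u)); [assumption|].
    exists 1%R. split; [lra|]. intros u _ _. simpl. ring.
- rewrite <- (is_psum_0 _ _ He). f_equal. ring.
Qed.

(** * Global solutions of Lipschitz differential equations *)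

Definition is_Rderive (f : R -> C) (t : R) (l : C) : Prop :=
  is_derive (K := R_AbsRing) (V := C_R_NormedModule) f t l.

Lemma norm_C_R (z : C) : norm (V := C_R_NormedModule) z = Cmod z.
Proof.
change (sqrt (Rabs (fst z) ^ 2 + Rabs (snd z) ^ 2) = Cmod z). now rewrite !pow2_abs.
Qed.

Lemma Rle_pow_half a b c : (forall m : nat, a <= b + c * (/ 2) ^ m)%R -> (a <= b)%R.
Proof.
intros H. apply Rnot_lt_le. intros N.
assert (L : is_lim_seq (fun m => b + c * (/ 2) ^ m)%R (b + c * 0)%R).
{ apply is_lim_seq_plus'; [apply is_lim_seq_const|].
  apply is_lim_seq_mult'; [apply is_lim_seq_const|apply is_lim_seq_geom]. rewrite Rabs_pos_eq; lra. }
pose proof (is_lim_seq_le _ _ _ _ H (is_lim_seq_const a) L) as K. simpl in K. lra.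
Qed.

Lemma lipschitz_continuous (f : R -> C) (B t : R) : (0 <= B)%R ->
  (forall s t, Cmod (f s - f t) <= B * Rabs (s - t))%R ->
  continuous (T := R_UniformSpace) (U := C_UniformSpace) f t.
Proof.
intros HB H. apply (proj2 (filterlim_locally _ _)). intros eps.
assert (P : (0 < eps / (B + 1))%R) by (apply Rdiv_lt_0_compat; [apply cond_pos|lra]).
exists (mkposreal _ P). intros s Hs. apply (C_NormedModule_mixin_compat1 (f t) (f s) eps).
change (Cmod (f s - f t) < eps)%R. eapply Rle_lt_trans; [apply H|].
change (Rabs (s - t) < eps / (B + 1))%R in Hs.
apply Rle_lt_trans with ((B + 1) * Rabs (s - t))%R.
- apply Rmult_le_compat_r; [apply Rabs_pos|lra].
- apply (Rmult_lt_compat_l (B + 1)) in Hs; [|lra]. replace ((B + 1) * (eps / (B + 1)))%R with (pos eps) in Hs by (field; lra). exact Hs.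
Qed.

Notation CRInt := (RInt (V := C_R_CompleteNormedModule)).

(** Integration from 0 divides the weight exp(2 L |t|) by 2 L. In the corresponding weighted norm
    the Picard map of an L-Lipschitz field contracts by 1/2 on all of R, so no local solutions have
    to be patched together. *)
Lemma CRInt_norm_exp (g : R -> C) (K L t : R) : (0 < L)%R ->
  (forall s, continuous (T := R_UniformSpace) (U := C_UniformSpace) g s) ->
  (forall s, Cmod (g s) <= K * exp (2 * L * Rabs s))%R ->
  (Cmod (CRInt g 0 t) <= K / (2 * L) * exp (2 * L * Rabs t))%R.
Proof.
intros HL Hg HB.
assert (K0 : (0 <= K)%R).
{ specialize (HB 0%R). rewrite Rabs_R0, Rmult_0_r, exp_0 in HB. pose proof (Cmod_ge_0 (g 0%R)). lra. }
assert (KL : (0 <= K / (2 * L))%R) by (apply Rmult_le_pos; [assumption|left; apply Rinv_0_lt_compat; lra]).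
assert (I : forall a b, is_RInt (V := C_R_CompleteNormedModule) g a b (CRInt g a b)).
{ intros a b. apply (RInt_correct (V := C_R_CompleteNormedModule)).
  apply (ex_RInt_continuous (V := C_R_CompleteNormedModule)). intros z _. apply Hg. }
rewrite <- norm_C_R. destruct (Rle_dec 0 t) as [Ht|Ht].
- eapply Rle_trans.
  + apply (norm_RInt_le (V := C_R_NormedModule) g (fun s => K * exp (2 * L * s))%R 0 t _
      (minus (K / (2 * L) * exp (2 * L * t)) (K / (2 * L) * exp (2 * L * 0)))%R Ht); [|apply I|].
    * intros s Hs. rewrite norm_C_R. eapply Rle_trans; [apply HB|]. rewrite Rabs_pos_eq; lra.
    * apply (is_RInt_derive (V := R_CompleteNormedModule) (fun s => K / (2 * L) * exp (2 * L * s))%R).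
      -- intros s _. auto_derive; [trivial|]. field. lra.
      -- intros s _. apply (ex_derive_continuous (K := R_AbsRing) (V := R_NormedModule)). auto_derive. trivial.
  + change (minus ?x ?y) with (x - y)%R. rewrite Rmult_0_r, exp_0, (Rabs_pos_eq t Ht). lra.
- assert (Ht' : (t <= 0)%R) by lra.
  rewrite <- (opp_RInt_swap (V := C_R_CompleteNormedModule)).
  2:{ eexists. apply (is_RInt_swap (V := C_R_CompleteNormedModule)), I. }
  rewrite (norm_opp (V := C_R_NormedModule)).
  eapply Rle_trans.
  + apply (norm_RInt_le (V := C_R_NormedModule) g (fun s => K * exp (2 * L * - s))%R t 0 _
      (minus (- (K / (2 * L)) * exp (2 * L * - 0)) (- (K / (2 * L)) * exp (2 * L * - t)))%R Ht'); [|apply I|].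
    * intros s Hs. rewrite norm_C_R. eapply Rle_trans; [apply HB|]. rewrite Rabs_left1; lra.
    * apply (is_RInt_derive (V := R_CompleteNormedModule) (fun s => - (K / (2 * L)) * exp (2 * L * - s))%R).
      -- intros s _. auto_derive; [trivial|]. field. lra.
      -- intros s _. apply (ex_derive_continuous (K := R_AbsRing) (V := R_NormedModule)). auto_derive. trivial.
  + change (minus ?x ?y) with (x - y)%R. rewrite Ropp_0, Rmult_0_r, exp_0, (Rabs_left1 t Ht'). lra.
Qed.

(** A limit written as a telescoping series, so that convergence follows from the comparison
    test. *)
Definition Clim_seq (y : nat -> C) : C :=
  y 0%nat + (Series (fun n => Re (y (S n) - y n)), Series (fun n => Im (y (S n) - y n))).

Lemma Clim_seq_geom (y : nat -> C) (Q : R) :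
  (forall n, Cmod (y (S n) - y n) <= Q * (/ 2) ^ n)%R ->
  forall n, (Cmod (Clim_seq y - y n) <= 4 * Q * (/ 2) ^ n)%R.
Proof.
intros H.
assert (G : forall m, is_series (fun k => Q * (/ 2) ^ m * (/ 2) ^ k)%R (Q * (/ 2) ^ m * (/ (1 - / 2)))%R).
{ intros m. apply (is_series_scal (K := R_AbsRing) (V := R_NormedModule)). apply is_series_geom. rewrite Rabs_pos_eq; lra. }
destruct (is_Cseries_ex (fun n => y (S n) - y n) (fun k => Q * (/ 2) ^ 0 * (/ 2) ^ k)%R) as [l [Hl _]].
{ intros n. simpl pow at 1. rewrite Rmult_1_r. apply H. }
{ eexists. apply G. }
assert (T : forall m, is_Cseries (fun k => y (S (m + k))%nat - y (m + k)%nat) (y 0%nat + l - y m)).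
{ induction m.
  - replace (y 0%nat + l - y 0%nat) with l by ring. exact Hl.
  - apply is_series_C_iff.
    eapply is_series_ext; [|apply (is_series_incr_1 (K := C_AbsRing) (V := C_NormedModule) (fun k => y (S (m + k))%nat - y (m + k)%nat) (y 0%nat + l - y (S m)))].
    + intros k. simpl. now rewrite Nat.add_succ_r.
    + apply is_series_C_iff. rewrite Nat.add_0_r.
      change (is_Cseries (fun k => y (S (m + k))%nat - y (m + k)%nat) (y 0%nat + l - y (S m) + (y (S m) - y m))).
      replace (y 0%nat + l - y (S m) + (y (S m) - y m)) with (y 0%nat + l - y m) by ring. exact IHm. }
assert (E : Clim_seq y = y 0%nat + l).
{ destruct Hl as [H1 H2]. unfold Clim_seq. rewrite (is_series_unique _ _ H1), (is_series_unique _ _ H2). now destruct l. }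
rewrite E. intros m. eapply Rle_trans; [apply (fun h => is_Cseries_bound _ _ _ _ h (G m) (T m))|].
- intros k. eapply Rle_trans; [apply H|]. rewrite pow_add. right; ring.
- right. field.
Qed.

Lemma cauchy_lipschitz (F : C -> C) (B L : R) (y0 : C) : (0 <= B)%R -> (0 < L)%R ->
  (forall x, Cmod (F x) <= B)%R ->
  (forall x x', Cmod (F x - F x') <= L * Cmod (x - x'))%R ->
  exists y : R -> C, y 0%R = y0 /\ forall t, is_Rderive y t (F (y t)).
Proof.
intros HB HL FB FL.
set (Y := fix Y (n : nat) : R -> C :=
  match n with O => fun _ => y0 | S m => fun t => y0 + CRInt (fun s => F (Y m s)) 0 t end).
(* Since |F| <= B, all iterates and their limit are B-Lipschitz; this supplies the continuity, hence
   the integrability, of every integrand below. *)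
assert (Lip_cont : forall f : R -> C, (forall s t, Cmod (f s - f t) <= B * Rabs (s - t))%R -> forall s,
  continuous (T := R_UniformSpace) (U := C_UniformSpace) (fun s => F (f s)) s).
{ intros f Hf s. apply lipschitz_continuous with (L * B)%R; [apply Rmult_le_pos; lra|].
  intros a b. eapply Rle_trans; [apply FL|]. rewrite Rmult_assoc. apply Rmult_le_compat_l; [lra|apply Hf]. }
assert (Int : forall f : R -> C, (forall s, continuous (T := R_UniformSpace) (U := C_UniformSpace) (fun s => F (f s)) s) ->
  forall a b, is_RInt (V := C_R_CompleteNormedModule) (fun s => F (f s)) a b (CRInt (fun s => F (f s)) a b)).
{ intros f Hf a b. apply (RInt_correct (V := C_R_CompleteNormedModule)).
  apply (ex_RInt_continuous (V := C_R_CompleteNormedModule)). intros z _. apply Hf. }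
assert (Int_lip : forall f : R -> C, (forall s, continuous (T := R_UniformSpace) (U := C_UniformSpace) (fun s => F (f s)) s) ->
  forall s t, (Cmod (CRInt (fun s => F (f s)) 0 s - CRInt (fun s => F (f s)) 0 t) <= B * Rabs (s - t))%R).
{ intros f Hf.
  assert (Hle : forall s t, (t <= s)%R -> (Cmod (CRInt (fun s => F (f s)) 0 s - CRInt (fun s => F (f s)) 0 t) <= B * Rabs (s - t))%R).
  { intros s t Hts.
    replace (CRInt (fun s => F (f s)) 0 s - CRInt (fun s => F (f s)) 0 t) with (CRInt (fun s => F (f s)) t s).
    - rewrite <- norm_C_R, Rabs_pos_eq, Rmult_comm by lra.
      apply (norm_RInt_le_const (V := C_R_NormedModule) (fun s => F (f s)) t s); [assumption| |apply (Int f Hf)].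
      intros x _. rewrite norm_C_R. apply FB.
    - rewrite <- (RInt_Chasles (V := C_R_CompleteNormedModule) (fun s => F (f s)) 0 t s); [|eexists; apply (Int f Hf)|eexists; apply (Int f Hf)].
      change (plus ?x ?y) with (Cplus x y). symmetry. Cring. }
  intros s t. destruct (Rle_dec t s); [now apply Hle|].
  rewrite Rabs_minus_sym. rewrite <- Cmod_opp, Copp_minus_distr. apply Hle. lra. }
assert (Y_lip : forall n s t, (Cmod (Y n s - Y n t) <= B * Rabs (s - t))%R).
{ induction n; intros s t.
  - simpl. replace (y0 - y0) with (RtoC 0) by ring. rewrite Cmod_0. apply Rmult_le_pos; [assumption|apply Rabs_pos].
  - simpl. match goal with |- (Cmod (y0 + ?a - (y0 + ?b)) <= _)%R => replace (y0 + a - (y0 + b)) with (a - b) by ring end.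
    apply Int_lip, Lip_cont, IHn. }
assert (Y_cont := fun n => Lip_cont _ (Y_lip n)).
(* The first Picard step is at most B |t|, and x <= exp x bounds this by [K] exp(2 L |t|). *)
set (K := (B / (2 * L))%R).
assert (Int_diff : forall f g : R -> C, (forall s t, Cmod (f s - f t) <= B * Rabs (s - t))%R ->
  (forall s t, Cmod (g s - g t) <= B * Rabs (s - t))%R -> forall M,
  (forall t, Cmod (f t - g t) <= M * exp (2 * L * Rabs t))%R ->
  forall t, (Cmod (CRInt (fun s => F (f s)) 0 t - CRInt (fun s => F (g s)) 0 t) <= M / 2 * exp (2 * L * Rabs t))%R).
{ intros f g Lf Lg M HM t. specialize (Lip_cont f Lf) as Cf. specialize (Lip_cont g Lg) as Cg.
  assert (E : CRInt (fun s => minus (F (f s)) (F (g s))) 0 t = minus (CRInt (fun s => F (f s)) 0 t) (CRInt (fun s => F (g s)) 0 t)).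
  { apply (RInt_minus (V := C_R_CompleteNormedModule)); eexists; apply Int; assumption. }
  change (Cmod (minus (CRInt (fun s => F (f s)) 0 t) (CRInt (fun s => F (g s)) 0 t)) <= M / 2 * exp (2 * L * Rabs t))%R.
  rewrite <- E. replace (M / 2)%R with (L * M / (2 * L))%R by (field; lra).
  apply CRInt_norm_exp; [assumption| |].
  - intros s. apply (continuous_minus (K := R_AbsRing) (V := C_R_NormedModule)); auto.
  - intros s. rewrite Rmult_assoc. change (Cmod (F (f s) - F (g s)) <= L * (M * exp (2 * L * Rabs s)))%R.
    eapply Rle_trans; [apply FL|]. apply Rmult_le_compat_l; [lra|apply HM]. }
assert (Y_step : forall n t, (Cmod (Y (S n) t - Y n t) <= K * exp (2 * L * Rabs t) * (/ 2) ^ n)%R).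
{ induction n; intros t.
  - simpl. assert (H := Int_lip (Y 0%nat) (Y_cont 0%nat) t 0%R). rewrite (RInt_point (V := C_R_CompleteNormedModule)), Rminus_0_r in H.
    match goal with |- (Cmod (y0 + ?a - y0) <= _)%R => replace (y0 + a - y0) with (a - 0) by ring end.
    eapply Rle_trans; [apply H|]. rewrite Rmult_1_r. unfold K.
    assert (X := exp_ineq1_le (2 * L * Rabs t)).
    apply Rle_trans with (B / (2 * L) * (2 * L * Rabs t))%R; [right; field; lra|].
    apply Rmult_le_compat_l; [|lra]. apply Rmult_le_pos; [assumption|left; apply Rinv_0_lt_compat; lra].
  - replace (Y (S (S n)) t - Y (S n) t) with (CRInt (fun s => F (Y (S n) s)) 0 t - CRInt (fun s => F (Y n s)) 0 t) by (simpl; ring).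
    eapply Rle_trans; [apply (Int_diff _ _ (Y_lip (S n)) (Y_lip n) (K * (/ 2) ^ n)%R)|].
    + intros s. eapply Rle_trans; [apply IHn|]. right; ring.
    + right. simpl. field. }
set (y := fun t => Clim_seq (fun n => Y n t)).
assert (y_lim : forall n t, (Cmod (y t - Y n t) <= 4 * K * (/ 2) ^ n * exp (2 * L * Rabs t))%R).
{ intros n t. eapply Rle_trans; [apply (Clim_seq_geom (fun n => Y n t) (K * exp (2 * L * Rabs t)))|].
  - intros m. apply Y_step.
  - right; ring. }
assert (y_lip : forall s t, (Cmod (y s - y t) <= B * Rabs (s - t))%R).
{ intros s t. apply Rle_pow_half with (4 * K * exp (2 * L * Rabs s) + 4 * K * exp (2 * L * Rabs t))%R. intros m.
  replace (y s - y t) with ((y s - Y m s) + ((Y m s - Y m t) + - (y t - Y m t))) by ring.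
  eapply Rle_trans; [apply Cmod_triangle|]. pose proof (Cmod_triangle (Y m s - Y m t) (- (y t - Y m t))) as T.
  rewrite Cmod_opp in T. pose proof (y_lim m s). pose proof (y_lim m t). pose proof (Y_lip m s t). lra. }
(* The limit and its Picard image are both within O(2^(-m)) of [Y (S m)] at t; letting m grow yields
   the integral equation. *)
assert (y_int : forall t, y t = y0 + CRInt (fun s => F (y s)) 0 t).
{ intros t. apply Ceq_minus, Cmod_eq_0, Rle_antisym; [|apply Cmod_ge_0].
  apply Rle_pow_half with (4 * K * exp (2 * L * Rabs t))%R. intros m.
  pose proof (y_lim (S m) t) as H1.
  assert (H2 := Int_diff _ _ (Y_lip m) y_lip (4 * K * (/ 2) ^ m)%R
    (fun t => eq_ind _ (fun x => (x <= _)%R) (y_lim m t) _ (eq_trans (eq_sym (Cmod_opp _)) (f_equal Cmod (Copp_minus_distr _ _)))) t).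
  replace (y t - (y0 + CRInt (fun s => F (y s)) 0 t)) with
    ((y t - Y (S m) t) + (CRInt (fun s => F (Y m s)) 0 t - CRInt (fun s => F (y s)) 0 t)) by (simpl; ring).
  eapply Rle_trans; [apply Cmod_triangle|]. simpl pow in H1. lra. }
exists y. split.
- rewrite y_int, (RInt_point (V := C_R_CompleteNormedModule)). change (y0 + 0 = y0). ring.
- intros t. assert (D : is_Rderive (fun t => CRInt (fun s => F (y s)) 0 t) t (F (y t))).
  { apply (is_derive_RInt (V := C_R_NormedModule) (fun s => F (y s)) _ 0 t).
    - apply filter_forall. intros s. apply (Int y (Lip_cont y y_lip)).
    - apply (Lip_cont y y_lip). }
  apply (is_derive_ext (K := R_AbsRing) (V := C_R_NormedModule) (fun t => plus y0 (CRInt (fun s => F (y s)) 0 t))).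
  + intros s. now rewrite (y_int s).
  + replace (F (y t)) with (plus zero (F (y t))) by apply plus_zero_l.
    apply (is_derive_plus (K := R_AbsRing) (V := C_R_NormedModule)); [apply (is_derive_const (K := R_AbsRing) (V := C_R_NormedModule))|exact D].
Qed.

(** * Curves in the plane *)

Lemma is_Rderive_iff f t l : is_Rderive f t l <->
  forall eps, (0 < eps)%R -> exists delta, (0 < delta)%R /\
   forall s, (Rabs (s - t) < delta)%R -> (Cmod (f s - f t - RtoC (s - t) * l) <= eps * Rabs (s - t))%R.
Proof.
assert (E : forall s, norm (V := C_R_NormedModule) (minus (minus (f s) (f t)) (scal (minus s t) l)) =
  Cmod (f s - f t - RtoC (s - t) * l)).
{ intros s. rewrite norm_C_R, scal_R_Cmult. reflexivity. }
split.
- intros [_ H] eps Heps.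
  specialize (H t (fun P HP => HP) (mkposreal eps Heps)).
  destruct H as [d Hd]. exists d; split; [apply cond_pos|].
  intros s Hs. rewrite <- E. exact (Hd s Hs).
- intros H; split.
  + apply (is_linear_scal_l (K := R_AbsRing) (V := C_R_NormedModule)).
  + intros x Hx. rewrite <- (is_filter_lim_locally_unique _ _ Hx).
    intros eps. destruct (H eps (cond_pos eps)) as [d [Hd1 Hd2]].
    exists (mkposreal d Hd1). intros s Hs. specialize (Hd2 s Hs). rewrite <- E in Hd2. exact Hd2.
Qed.

Lemma is_derive_R_iff (f : R -> R) t l : is_derive f t l <->
  forall eps, (0 < eps)%R -> exists delta, (0 < delta)%R /\
   forall s, (Rabs (s - t) < delta)%R -> (Rabs (f s - f t - (s - t) * l) <= eps * Rabs (s - t))%R.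
Proof.
split.
- intros [_ H] eps Heps.
  specialize (H t (fun P HP => HP) (mkposreal eps Heps)).
  destruct H as [d Hd]. exists d; split; [apply cond_pos|]. intros s Hs. exact (Hd s Hs).
- intros H; split.
  + apply (is_linear_scal_l (K := R_AbsRing) (V := R_NormedModule)).
  + intros x Hx. rewrite <- (is_filter_lim_locally_unique _ _ Hx).
    intros eps. destruct (H eps (cond_pos eps)) as [d [Hd1 Hd2]].
    exists (mkposreal d Hd1). intros s Hs. exact (Hd2 s Hs).
Qed.

Lemma is_Rderive_Re_Im f t l : is_Rderive f t l <->
  is_derive (fun s => Re (f s)) t (Re l) /\ is_derive (fun s => Im (f s)) t (Im l).
Proof.
assert (E : forall s, Re (f s - f t - RtoC (s - t) * l) = (Re (f s) - Re (f t) - (s - t) * Re l)%R /\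
  Im (f s - f t - RtoC (s - t) * l) = (Im (f s) - Im (f t) - (s - t) * Im l)%R).
{ intros s. split; simpl; unfold Re, Im; ring. }
rewrite is_Rderive_iff, !is_derive_R_iff. split.
- intros H. split; intros eps Heps; destruct (H eps Heps) as [d [Hd K]]; exists d; (split; [assumption|]);
  intros s Hs; destruct (E s) as [E1 E2].
  + rewrite <- E1. eapply Rle_trans; [apply re_le_Cmod|auto].
  + rewrite <- E2. eapply Rle_trans; [apply im_le_Cmod|auto].
- intros [H1 H2] eps Heps.
  destruct (H1 (eps / 2)%R ltac:(lra)) as [d1 [P1 K1]]. destruct (H2 (eps / 2)%R ltac:(lra)) as [d2 [P2 K2]].
  exists (Rmin d1 d2). split; [now apply Rmin_pos|]. intros s Hs. destruct (E s) as [E1 E2].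
  specialize (K1 s ltac:(eapply Rlt_le_trans; [apply Hs|apply Rmin_l])).
  specialize (K2 s ltac:(eapply Rlt_le_trans; [apply Hs|apply Rmin_r])).
  rewrite <- E1 in K1. rewrite <- E2 in K2.
  eapply Rle_trans; [apply Cmod_le_Re_Im|]. lra.
Qed.

Lemma is_Rderive_const (a : C) t : is_Rderive (fun _ => a) t 0.
Proof. exact (is_derive_const (K := R_AbsRing) (V := C_R_NormedModule) a t). Qed.

Lemma is_Rderive_plus f g t df dg : is_Rderive f t df -> is_Rderive g t dg ->
  is_Rderive (fun s => f s + g s) t (df + dg).
Proof. exact (is_derive_plus (K := R_AbsRing) (V := C_R_NormedModule) f g t df dg). Qed.

Lemma is_Rderive_mult f g t df dg : is_Rderive f t df -> is_Rderive g t dg ->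
  is_Rderive (fun s => f s * g s) t (df * g t + f t * dg).
Proof.
rewrite !is_Rderive_Re_Im. intros [A1 A2] [B1 B2].
assert (M : forall (a b : R -> R) la lb, is_derive a t la -> is_derive b t lb ->
  is_derive (fun s => a s * b s)%R t (la * b t + a t * lb)%R).
{ intros a b la lb Ha Hb. exact (is_derive_mult (K := R_AbsRing) a b t la lb Ha Hb Rmult_comm). }
split.
- replace (Re (df * g t + f t * dg)) with
    (minus (Re df * Re (g t) + Re (f t) * Re dg) (Im df * Im (g t) + Im (f t) * Im dg))%R
    by (rewrite re_plus, !re_mult; change (minus ?x ?y) with (x - y)%R; Rring).
  apply (is_derive_minus (K := R_AbsRing) (V := R_NormedModule)); now apply M.
- replace (Im (df * g t + f t * dg)) with
    (plus (Re df * Im (g t) + Re (f t) * Im dg) (Im df * Re (g t) + Im (f t) * Re dg))%R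
    by (rewrite im_plus, !im_mult; change (plus ?x ?y) with (x + y)%R; Rring).
  apply (is_derive_plus (K := R_AbsRing) (V := R_NormedModule)); now apply M.
Qed.

Lemma is_Rderive_ext_loc (f g : R -> C) t l r : (0 < r)%R ->
  (forall s, (Rabs (s - t) < r)%R -> f s = g s) -> is_Rderive f t l -> is_Rderive g t l.
Proof.
intros Hr E. apply (is_derive_ext_loc (K := R_AbsRing) (V := C_R_NormedModule)).
exists (mkposreal r Hr). intros s Hs. apply E, Hs.
Qed.

Lemma is_Rderive_conj_opp f t l : is_Rderive f (- t)%R l -> is_Rderive (fun s => Cconj (f (- s)%R)) t (- Cconj l).
Proof.
rewrite !is_Rderive_iff. intros H eps Heps. destruct (H eps Heps) as [d [Hd K]].
exists d. split; [assumption|]. intros s Hs.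
assert (E : (Rabs (- s - - t) = Rabs (s - t))%R) by (rewrite <- Rabs_Ropp; f_equal; ring).
specialize (K (- s)%R). rewrite E in K. rewrite <- Cmod_conj.
replace (Cconj (Cconj (f (- s)%R) - Cconj (f (- t)%R) - RtoC (s - t) * - Cconj l)) with (f (- s)%R - f (- t)%R - RtoC (- s - - t) * l); [auto|].
apply injective_projections; simpl; ring.
Qed.

Definition glue (b a : R -> C) (t : R) : C := if Rle_dec 0 t then a t else b t.

(** At t = 0 both branches have a two-sided derivative with the same value; in the application each
    branch is defined for all times. *)
Lemma is_Rderive_glue (b a : R -> C) l t : b 0%R = a 0%R ->
  ((t <= 0)%R -> is_Rderive b t l) -> ((0 <= t)%R -> is_Rderive a t l) -> is_Rderive (glue b a) t l.
Proof.
intros E Hb Ha. destruct (Rtotal_order t 0) as [N|[->|P]].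
- apply is_Rderive_ext_loc with b (- t)%R; [lra| |apply Hb; lra].
  intros s Hs%Rabs_lt_between. unfold glue. destruct (Rle_dec 0 s); [lra|reflexivity].
- specialize (Ha (Rle_refl _)). specialize (Hb (Rle_refl _)). rewrite is_Rderive_iff in *.
  intros eps Heps. destruct (Ha eps Heps) as [d1 [P1 K1]]. destruct (Hb eps Heps) as [d2 [P2 K2]].
  exists (Rmin d1 d2). split; [now apply Rmin_pos|]. intros s Hs.
  replace (glue b a 0) with (a 0%R) by (unfold glue; destruct (Rle_dec 0 0); [reflexivity|lra]).
  unfold glue. destruct (Rle_dec 0 s).
  + apply K1. eapply Rlt_le_trans; [apply Hs|apply Rmin_l].
  + rewrite <- E. apply K2. eapply Rlt_le_trans; [apply Hs|apply Rmin_r].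
- apply is_Rderive_ext_loc with a t; [lra| |apply Ha; lra].
  intros s Hs%Rabs_lt_between. unfold glue. destruct (Rle_dec 0 s); [reflexivity|lra].
Qed.

(* All derivatives of [y ^ 3] along the flow [y' = i (1 - y ^ 3)] are polynomials in y. *)
Inductive pexpr : Type :=
| PX : pexpr
| PC : C -> pexpr
| PAdd : pexpr -> pexpr -> pexpr
| PMul : pexpr -> pexpr -> pexpr.

Fixpoint peval (e : pexpr) (y : C) : C :=
  match e with
  | PX => y
  | PC a => a
  | PAdd e1 e2 => peval e1 y + peval e2 y
  | PMul e1 e2 => peval e1 y * peval e2 y
  end.

Definition pcube : pexpr := PMul PX (PMul PX PX).

Fixpoint pderiv (e : pexpr) : pexpr :=
  match e with
  | PX => PMul (PC Ci) (PAdd (PC 1) (PMul (PC (- (1))) pcube))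
  | PC _ => PC 0
  | PAdd e1 e2 => PAdd (pderiv e1) (pderiv e2)
  | PMul e1 e2 => PAdd (PMul (pderiv e1) e2) (PMul e1 (pderiv e2))
  end.

Lemma pderiv_correct (y : R -> C) t e : is_Rderive y t (Ci * (1 - y t ^ 3)) ->
  is_Rderive (fun s => peval e (y s)) t (peval (pderiv e) (y t)).
Proof.
intros H. induction e; simpl.
- replace (Ci * (1 + - (1) * (y t * (y t * y t)))) with (Ci * (1 - y t ^ 3)) by ring. exact H.
- apply is_Rderive_const.
- now apply is_Rderive_plus.
- now apply (is_Rderive_mult (fun s => peval e1 (y s)) (fun s => peval e2 (y s))).
Qed.

(** [smooth_lift] asks for all derivatives on one neighbourhood, which iterating the formal
    derivation provides. The constant - a centres the coordinate z at the current point. *)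
Definition cube_lift (a : C) (y : R -> C) (n : nat) (s : R) : C :=
  peval (Nat.iter n pderiv (PAdd pcube (PC (- a)))) (y s).

Lemma cube_smooth_lift (y : R -> C) t : (forall t, is_Rderive y t (Ci * (1 - y t ^ 3))) ->
  smooth_lift (fun s => Some (y s ^ 3)) t (cube_lift (y t ^ 3) y).
Proof.
intros y_flow. split.
- apply filter_forall. intros s. simpl. f_equal. unfold cube_lift. simpl. ring.
- apply filter_forall. intros s n. apply pderiv_correct, y_flow.
Qed.

Lemma cube_lift_1 (y : R -> C) t : cube_lift (y t ^ 3) y 1 t = 3 * y t ^ 2 * (Ci * (1 - y t ^ 3)).
Proof. unfold cube_lift. simpl. ring. Qed.

(** For z = y^3 the flow gives z'' / z' = y' (2 / y - 3 y^2 / (1 - y^3)), which is - [conn_coef z]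
    z'. The geodesic equation is thus a rational identity in y, valid off y = 0 and y^3 = 1. *)
Lemma cube_geodesic (y : R -> C) : (forall t, is_Rderive y t (Ci * (1 - y t ^ 3))) ->
  (forall t, y t ^ 3 <> 0) -> (forall t, y t ^ 3 <> 1) ->
  geodesic connection m_infty p_infty (fun t => Some (y t ^ 3)).
Proof.
intros y_flow H0 H1. split; [exact I|]. intros t _.
destruct (connection_regular (y t ^ 3) (H0 t) (H1 t)) as [e [He E0]]. split.
- intros N. apply N. now exists e.
- exists (cube_lift (y t ^ 3) y), e. split; [now apply cube_smooth_lift|split; [exact He|]].
  rewrite E0, cube_lift_1. unfold conn_coef.
  assert (Y : y t <> 0) by (intros Z; apply (H0 t); rewrite Z; simpl; ring).
  assert (Z : y t ^ 3 - 1 <> 0) by now apply Cminus_eq_contra.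
  unfold cube_lift. simpl. simpl in Z. field. split; [|assumption].
  intros K. apply Z. rewrite <- K. ring.
Qed.

(** * The orbit of -1/2 *)

Lemma derive_nonpos_le (f f' : R -> R) (a b : R) : (a <= b)%R ->
  (forall t, a <= t <= b -> is_derive f t (f' t))%R -> (forall t, a <= t <= b -> f' t <= 0)%R -> (f b <= f a)%R.
Proof.
intros Hab D N. destruct (MVT_gen f a b f') as [c [Hc E]]; rewrite ?Rmin_left, ?Rmax_right in * by lra.
- intros x Hx. apply D. lra.
- intros x Hx. apply continuity_pt_filterlim. apply (ex_derive_continuous (K := R_AbsRing) (V := R_NormedModule)).
  eexists; apply D; lra.
- specialize (N c Hc). nra.
Qed.

Definition r3 : R := sqrt 3.
Lemma r3_sqr : (r3 * r3 = 3)%R. Proof. apply sqrt_sqrt. lra. Qed.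

Lemma r3_bounds : (1732 / 1000 < r3 < 1733 / 1000)%R.
Proof. 
assert (0 <= r3)%R by apply sqrt_pos. pose proof r3_sqr. split; nra.
Qed.

(* exp(2 pi i / 3) and exp(- pi i / 6). *)
Definition omega : C := (- (1 / 2), r3 / 2)%R.
Definition rot : C := (r3 / 2, - (1 / 2))%R.

Lemma omega_cube : omega ^ 3 = 1.
Proof.
pose proof r3_sqr as H.
replace (omega ^ 3) with (omega * Cconj omega); [apply injective_projections; simpl; lra|].
replace (omega ^ 3) with (omega * (omega * omega)) by (simpl; ring).
f_equal. apply injective_projections; simpl; lra.
Qed.

Lemma omega_rot : omega * rot = Ci.
Proof. pose proof r3_sqr. apply injective_projections; simpl; lra. Qed.

(* With y = omega (1 - E) the equation y' = i (1 - y^3) becomes E' = - rot E (quad E). *)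
Definition quad (E : C) : C := 3 - 3 * E + E ^ 2.

Lemma quad_cube E : E * quad E = 1 - (1 - E) ^ 3.
Proof. unfold quad. simpl. ring. Qed.

Lemma Cmod_sqr (z : C) : (Cmod z ^ 2 = Re z * Re z + Im z * Im z)%R.
Proof. rewrite Cmod2_alt. ring. Qed.

(* In the orbit this makes |E| decrease exponentially. The proof uses coordinates (p, q) of the
   plane rotated by pi/6. *)
Lemma rot_quad_pos E : (Cmod E ^ 2 <= 3 / 4 -> 3 / 10 <= Re (rot * quad E))%R.
Proof.
rewrite Cmod_sqr. destruct E as [x y]. unfold Re, Im; simpl. intros H.
pose proof r3_sqr as S3. pose proof r3_bounds as [B1 B2].
(* p + i q = rot E, so Re (rot quad E) = 3 r3 / 2 - 3 p + (r3 / 2) (p^2 - q^2) - p q. *)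
set (p := ((r3 * x + y) / 2)%R). set (q := ((r3 * y - x) / 2)%R).
assert (Ep : (p * p = (3 * (x * x) + 2 * r3 * (x * y) + y * y) / 4)%R) by (rewrite <- S3; unfold p; field).
assert (Eq : (q * q = (3 * (y * y) - 2 * r3 * (x * y) + x * x) / 4)%R) by (rewrite <- S3; unfold q; field).
assert (Epq : (p * q = (3 * (x * y) - r3 * (x * x) + r3 * (y * y) - x * y) / 4)%R) by (rewrite <- S3; unfold p, q; field).
assert (H' : (p * p + q * q <= 3 / 4)%R) by lra.
(* Weighted AM-GM. Trading q^2 for 3/4 - p^2 then leaves about 2.1 p^2 - 3 p + 1.41, with vertex 5/7
   and minimum about 0.34: hence the square of p - 5/7 below, and room for 3/10. *)
assert (K1 : (p * q <= 7 / 20 * (p * p) + 5 / 7 * (q * q))%R) by (pose proof (Rle_0_sqr (p - 10 / 7 * q)) as Q; unfold Rsqr in Q; lra).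
assert (K2 : (3 / 10 <= 3 * r3 / 2 - 3 * p + r3 / 2 * (p * p - q * q) - p * q)%R).
{ clear Ep Eq Epq H. clearbody p q.
  assert (0 <= (r3 - 1732 / 1000) * (3 / 2 + (p * p - q * q) / 2))%R by (apply Rmult_le_pos; nra).
  assert (0 <= p * p - 10 / 7 * p + 25 / 49)%R by (pose proof (Rle_0_sqr (p - 5 / 7)) as Q; unfold Rsqr in Q; lra).
  pose proof (Rle_0_sqr q) as Q; unfold Rsqr in Q. lra. }
eapply Rle_trans; [apply K2|]. right.
replace (r3 / 2 * (p * p - q * q))%R with (r3 * (x * x - y * y) / 4 + 3 * (x * y) / 2)%R.
- rewrite Epq. unfold p. field.
- rewrite Ep, Eq. replace (3 * (x * y) / 2)%R with (r3 * r3 * (x * y) / 2)%R by (rewrite S3; field). field.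
Qed.

(** * The retraction, the cut-off field and its orbit *)

Definition retract (r : R) (z : C) : C := RtoC (r / Rmax r (Cmod z)) * z.

Lemma retract_factor r z : (0 < r)%R -> (0 < r / Rmax r (Cmod z) <= 1)%R.
Proof.
intros Hr. assert (H := Rmax_l r (Cmod z)). split.
- apply Rdiv_lt_0_compat; lra.
- apply Rle_div_l; lra.
Qed.

Lemma retract_bound r z : (0 < r)%R -> (Cmod (retract r z) <= r)%R.
Proof.
intros Hr. assert (H := Rmax_l r (Cmod z)). unfold retract.
rewrite Cmod_mult, Cmod_R, Rabs_pos_eq by (apply Rlt_le, retract_factor, Hr).
unfold Rdiv. rewrite Rmult_assoc. rewrite <- (Rmult_1_r r) at 3. apply Rmult_le_compat_l; [lra|].
rewrite Rmult_comm. apply Rle_div_l; [lra|]. rewrite Rmult_1_l. apply Rmax_r.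
Qed.

Lemma retract_id r z : (0 < r)%R -> (Cmod z <= r)%R -> retract r z = z.
Proof.
intros Hr H. unfold retract. rewrite Rmax_left by assumption. replace (r / r)%R with 1%R by (field; lra). ring.
Qed.

(** The difference splits into moving the point at a fixed factor and changing the factor at a fixed
    point. Each part is at most |z - w|, the second by |n - m| <= |z - w| and |w| <= n. *)
Lemma retract_lipschitz r z w : (0 < r)%R -> (Cmod (retract r z - retract r w) <= 2 * Cmod (z - w))%R.
Proof.
intros Hr. unfold retract. set (m := Rmax r (Cmod z)). set (n := Rmax r (Cmod w)).
assert (Hm : (r <= m)%R) by apply Rmax_l. assert (Hn : (r <= n)%R) by apply Rmax_l.
assert (Hw : (Cmod w <= n)%R) by apply Rmax_r.
assert (Hmn : (Rabs (n - m) <= Cmod (z - w))%R).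
{ assert (T1 := Cmod_triangle (z - w) w). assert (T2 := Cmod_triangle (w - z) z).
  replace (z - w + w) with z in T1 by ring. replace (w - z + z) with w in T2 by ring.
  rewrite <- (Cmod_opp (w - z)), Copp_minus_distr in T2.
  pose proof (Cmod_ge_0 (z - w)).
  apply Rabs_le. unfold m, n, Rmax. destruct (Rle_dec r (Cmod z)), (Rle_dec r (Cmod w)); lra. }
replace (RtoC (r / m) * z - RtoC (r / n) * w) with (RtoC (r / m) * (z - w) + RtoC (r / m * ((n - m) / n)) * w).
2:{ replace (r / m * ((n - m) / n))%R with (r / m - r / n)%R by (field; lra). rewrite RtoC_minus. ring. }
assert (F : (0 <= r / m <= 1)%R) by (split; [left; apply Rdiv_lt_0_compat; lra|apply Rle_div_l; lra]).
eapply Rle_trans; [apply Cmod_triangle|]. rewrite !Cmod_mult, !Cmod_R, Rabs_mult, (Rabs_pos_eq (r / m)) by apply F.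
assert (X : (Rabs ((n - m) / n) * Cmod w <= Cmod (z - w))%R).
{ unfold Rdiv. rewrite Rabs_mult, (Rabs_pos_eq (/ n)) by (left; apply Rinv_0_lt_compat; lra).
  apply Rle_trans with (Rabs (n - m) * (/ n * n))%R.
  - rewrite Rmult_assoc. apply Rmult_le_compat_l; [apply Rabs_pos|]. apply Rmult_le_compat_l; [left; apply Rinv_0_lt_compat; lra|assumption].
  - rewrite Rinv_l by lra. lra. }
pose proof (Cmod_ge_0 (z - w)). pose proof (Cmod_ge_0 w). pose proof (Rabs_pos ((n - m) / n)).
assert (0 <= Rabs ((n - m) / n) * Cmod w)%R by now apply Rmult_le_pos.
nra.
Qed.

(* Retracting onto the disc makes the field globally Lipschitz; the orbit never leaves the disc. *)
Definition cut (E : C) : C := retract (r3 / 2) E.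

Lemma cut_bounds E : (Cmod (cut E) ^ 2 <= 3 / 4)%R /\ (Cmod (cut E) <= 1)%R.
Proof.
pose proof r3_bounds. pose proof r3_sqr.
assert (H1 := retract_bound (r3 / 2) E ltac:(lra)). fold (cut E) in H1. pose proof (Cmod_ge_0 (cut E)).
split; [|lra]. apply Rle_trans with ((r3 / 2) ^ 2)%R; [apply pow_incr; lra|simpl; lra].
Qed.

Lemma Cmod_RtoC_pos (x : R) : (0 <= x)%R -> Cmod (RtoC x) = x.
Proof. intros H. rewrite Cmod_R. now apply Rabs_pos_eq. Qed.

Lemma quad_bound E : (Cmod E <= 1)%R -> (Cmod (quad E) <= 7)%R.
Proof.
intros H. unfold quad. eapply Rle_trans; [apply Cmod_triangle|].
assert (T := Cmod_triangle 3 (- (3 * E))). rewrite Cmod_opp, Cmod_mult, !Cmod_RtoC_pos in T by lra.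
rewrite Cmod_pow. assert (Cmod E ^ 2 <= 1)%R by (rewrite <- (pow1 2); apply pow_incr; split; [apply Cmod_ge_0|assumption]).
fold (3 - 3 * E) in T. lra.
Qed.

Lemma Cmod_rot : Cmod rot = 1%R.
Proof.
unfold Cmod. replace (fst rot ^ 2 + snd rot ^ 2)%R with 1%R by (pose proof r3_sqr; simpl; lra). apply sqrt_1.
Qed.

Definition cut_field (E : C) : C := - rot * (cut E * quad (cut E)).

Lemma cut_field_bound E : (Cmod (cut_field E) <= 7)%R.
Proof.
unfold cut_field. rewrite !Cmod_mult, Cmod_opp, Cmod_rot, Rmult_1_l.
destruct (cut_bounds E) as [_ H]. pose proof (Cmod_ge_0 (cut E)). pose proof (quad_bound _ H).
pose proof (Cmod_ge_0 (quad (cut E))). nra.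
Qed.

(** 24 = 2 * 12: the retraction contributes 2, and 12 = 3 + 6 + 3 bounds the divided difference of E
    quad(E) on the unit disc. *)
Lemma cut_field_lipschitz E E' : (Cmod (cut_field E - cut_field E') <= 24 * Cmod (E - E'))%R.
Proof.
unfold cut_field. destruct (cut_bounds E) as [_ H]. destruct (cut_bounds E') as [_ H'].
assert (L := retract_lipschitz (r3 / 2) E E' ltac:(pose proof r3_bounds; lra)).
fold (cut E) in L. fold (cut E') in L. set (a := cut E) in *. set (b := cut E') in *.
replace (- rot * (a * quad a) - - rot * (b * quad b)) with
  (- rot * ((a - b) * (3 - 3 * (a + b) + (a * a + a * b + b * b)))) by (unfold quad; simpl; ring).
rewrite !Cmod_mult, Cmod_opp, Cmod_rot, Rmult_1_l.
assert (K : (Cmod (3 - 3 * (a + b) + (a * a + a * b + b * b)) <= 12)%R).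
{ pose proof (Cmod_ge_0 a). pose proof (Cmod_ge_0 b).
  assert (T1 := Cmod_triangle (3 - 3 * (a + b)) (a * a + a * b + b * b)).
  assert (T2 := Cmod_triangle 3 (- (3 * (a + b)))). rewrite Cmod_opp, Cmod_mult, !Cmod_RtoC_pos in T2 by lra.
  assert (T3 := Cmod_triangle a b).
  assert (T4 := Cmod_triangle (a * a + a * b) (b * b)). assert (T5 := Cmod_triangle (a * a) (a * b)).
  rewrite Cmod_mult in T4; rewrite (Cmod_mult a a), (Cmod_mult a b) in T5. fold (3 - 3 * (a + b)) in T2.
  assert (Cmod a * Cmod a <= 1)%R by nra. assert (Cmod a * Cmod b <= 1)%R by nra. assert (Cmod b * Cmod b <= 1)%R by nra.
  lra. }
pose proof (Cmod_ge_0 (a - b)). pose proof (Cmod_ge_0 (E - E')).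
eapply Rle_trans; [apply Rmult_le_compat; [assumption|apply Cmod_ge_0|apply L|apply K]|]. lra.
Qed.

Lemma Cmod_sqr_derive (f : R -> C) t l : is_Rderive f t l ->
  is_derive (fun s => Cmod (f s) ^ 2)%R t (2 * Re (Cconj (f t) * l))%R.
Proof.
intros [H1 H2]%is_Rderive_Re_Im.
apply (is_derive_ext (fun s => Re (f s) * Re (f s) + Im (f s) * Im (f s)))%R; [intros; now rewrite Cmod_sqr|].
replace (2 * Re (Cconj (f t) * l))%R with
  (plus (Re l * Re (f t) + Re (f t) * Re l) (Im l * Im (f t) + Im (f t) * Im l))%R
  by (change (plus ?x ?y) with (x + y)%R; match goal with |- @eq _ ?a ?b => change (@eq R a b) end; rewrite re_mult, re_conj, im_conj; ring).
apply (is_derive_plus (K := R_AbsRing) (V := R_NormedModule)).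
- exact (is_derive_mult (K := R_AbsRing) _ _ t _ _ H1 H1 Rmult_comm).
- exact (is_derive_mult (K := R_AbsRing) _ _ t _ _ H2 H2 Rmult_comm).
Qed.

(** [cut E] is a positive multiple k E, so the cut-off field is E times a scalar and |E|^2 has
    logarithmic derivative - 2 k Re (rot quad (cut E)). *)
Lemma conj_radial (E q : C) (k : R) : 
  (2 * Re (Cconj E * (- rot * (RtoC k * E * q))) = - (2 * k * Re (rot * q)) * Cmod E ^ 2)%R.
Proof.
rewrite Cmod_sqr. destruct E as [x y], q as [u v]. unfold rot, Re, Im; simpl. field.
Qed.

(* y = -1/2, i.e. 1 - E = - conj(omega) / 2. *)
Definition orbit_start : C := (3 / 4, - (r3 / 4))%R.

(** The orbit of the cut-off field starts on the circle |E|^2 = 3/4, and |E| decreases along it; so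
    it stays in the disc, where the cut-off field is the true one. *)
Lemma orbit_exists : exists E : R -> C, E 0%R = orbit_start /\ forall t, (0 <= t)%R ->
  is_Rderive E t (- rot * (E t * quad (E t))) /\
  (Cmod (E t) ^ 2 <= 3 / 4)%R /\ E t <> 0 /\ (Cmod (E t) ^ 2 * (1 + 6 / 10 * t) <= 3 / 4)%R.
Proof.
destruct (cauchy_lipschitz cut_field 7 24 orbit_start) as [E [E0 HE]];
  [lra|lra|apply cut_field_bound|apply cut_field_lipschitz|].
exists E. split; [assumption|].
assert (V0 : (Cmod (E 0) ^ 2 = 3 / 4)%R).
{ rewrite E0, Cmod_sqr. unfold orbit_start, Re, Im; simpl. pose proof r3_sqr. lra. }
set (k := fun t => (r3 / 2 / Rmax (r3 / 2) (Cmod (E t)))%R).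
set (V' := fun t => (- (2 * k t * Re (rot * quad (cut (E t)))) * Cmod (E t) ^ 2)%R).
assert (D : forall t, is_derive (fun s => Cmod (E s) ^ 2)%R t (V' t)).
{ intros t. unfold V'. rewrite <- conj_radial. apply (Cmod_sqr_derive E t _ (HE t)). }
(* The bound [Q] holds at every time, because [cut (E t)] lies in the disc wherever [E t] is; no
   first exit time has to be considered. *)
assert (Kp : forall t, (0 < k t <= 1)%R) by (intros t; apply retract_factor; pose proof r3_bounds; lra).
assert (Q : forall t, (3 / 10 <= Re (rot * quad (cut (E t))))%R) by (intros t; apply rot_quad_pos, cut_bounds).
assert (P2 : forall t, (0 <= Cmod (E t) ^ 2)%R) by (intros t; apply pow_le, Cmod_ge_0).
assert (B : forall t, (0 <= t)%R -> (Cmod (E t) ^ 2 <= 3 / 4)%R).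
{ intros t Ht. rewrite <- V0. apply (derive_nonpos_le (fun s => Cmod (E s) ^ 2)%R V' 0 t Ht); [intros; apply D|].
  intros s _. unfold V'. specialize (Kp s). specialize (Q s). specialize (P2 s).
  assert (0 <= k s * Re (rot * quad (cut (E s))))%R by (apply Rmult_le_pos; lra). nra. }
assert (C0 : forall t, (0 <= t)%R -> cut (E t) = E t).
{ intros t Ht. apply retract_id; [pose proof r3_bounds; lra|].
  apply Rnot_lt_le. intros N. specialize (B t Ht). pose proof r3_sqr. pose proof r3_bounds.
  assert (r3 / 2 * (r3 / 2) < Cmod (E t) * Cmod (E t))%R by (apply Rmult_le_0_lt_compat; lra). simpl in B. lra. }
assert (Q7 : forall t, (0 <= t)%R -> (k t * Re (rot * quad (cut (E t))) <= 7)%R).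
{ intros t Ht. destruct (cut_bounds (E t)) as [_ H1]. apply quad_bound in H1.
  pose proof (re_le_Cmod (rot * quad (cut (E t)))) as H2. rewrite Cmod_mult, Cmod_rot in H2.
  specialize (Q t). rewrite Rabs_pos_eq in H2 by lra. specialize (Kp t). nra. }
assert (K1 : forall t, (0 <= t)%R -> k t = 1%R).
{ intros t Ht. unfold k. rewrite Rmax_left; [field; pose proof r3_bounds; lra|].
  apply Rnot_lt_le. intros N. specialize (B t Ht). pose proof r3_sqr. pose proof r3_bounds.
  assert (r3 / 2 * (r3 / 2) < Cmod (E t) * Cmod (E t))%R by (apply Rmult_le_0_lt_compat; lra). simpl in B. lra. }
assert (De : forall c t, is_derive (fun s => Cmod (E s) ^ 2 * exp (c * s))%R t ((V' t + c * Cmod (E t) ^ 2) * exp (c * t))%R).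
{ intros c t.
  replace ((V' t + c * Cmod (E t) ^ 2) * exp (c * t))%R with (plus (mult (V' t) (exp (c * t))) (mult (Cmod (E t) ^ 2) (c * exp (c * t))))%R
    by (change (plus (V' t * exp (c * t)) (Cmod (E t) ^ 2 * (c * exp (c * t))) = (V' t + c * Cmod (E t) ^ 2) * exp (c * t))%R;
     change (V' t * exp (c * t) + (Cmod (E t) ^ 2 * (c * exp (c * t))) = (V' t + c * Cmod (E t) ^ 2) * exp (c * t))%R; ring).
  apply (is_derive_mult (K := R_AbsRing) (fun s => Cmod (E s) ^ 2)%R (fun s => exp (c * s))); [apply D| |apply Rmult_comm].
  auto_derive; [trivial|ring]. }
intros t Ht. split; [|split; [now apply B|split]].
- assert (H := HE t). unfold cut_field in H. now rewrite C0 in H.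
- intros Z.
  (* Gronwall from below: Re (rot quad) <= 7 gives a logarithmic decay rate of at most 14, so |E|^2
     exp(14 t) does not decrease from 3/4 and cannot reach 0. *)
  assert (H : (- (Cmod (E t) ^ 2 * exp (14 * t)) <= - (Cmod (E 0) ^ 2 * exp (14 * 0)))%R).
  { apply (derive_nonpos_le (fun s => - (Cmod (E s) ^ 2 * exp (14 * s)))%R (fun s => - ((V' s + 14 * Cmod (E s) ^ 2) * exp (14 * s)))%R 0 t Ht).
    - intros s _. apply (is_derive_opp (K := R_AbsRing) (V := R_NormedModule)), De.
    - intros s Hs. assert (0 <= V' s + 14 * Cmod (E s) ^ 2)%R.
      { unfold V'. specialize (Q7 s ltac:(lra)). specialize (P2 s). nra. }
      pose proof (exp_pos (14 * s)). nra. }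
  rewrite V0, Z, Cmod_0, Rmult_0_r, exp_0 in H. simpl in H. lra.
(* The rate 6/10 is twice the 3/10 of [rot_quad_pos]; exp x >= 1 + x then weakens exponential decay
   to the stated rational bound. *)
- assert (H : (Cmod (E t) ^ 2 * exp (6 / 10 * t) <= Cmod (E 0) ^ 2 * exp (6 / 10 * 0))%R).
  { apply (derive_nonpos_le (fun s => Cmod (E s) ^ 2 * exp (6 / 10 * s))%R (fun s => (V' s + 6 / 10 * Cmod (E s) ^ 2) * exp (6 / 10 * s))%R 0 t Ht).
    - intros s _. apply De.
    - intros s Hs. assert (V' s + 6 / 10 * Cmod (E s) ^ 2 <= 0)%R.
      { unfold V'. rewrite K1 by lra. specialize (Q s). specialize (P2 s). nra. }
      pose proof (exp_pos (6 / 10 * s)). nra. }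
  rewrite V0, Rmult_0_r, exp_0 in H. specialize (P2 t). pose proof (exp_ineq1_le (6 / 10 * t)). nra.
Qed.

(* If [Im W] had no zero after [T], then [atan (Re W / Im W)], a bounded function, would decrease at unit speed. *)
Lemma spiral_real (W kappa : R -> C) (T : R) :
  (forall t, T <= t -> is_Rderive W t (kappa t * W t))%R -> (forall t, T <= t -> 1 <= Im (kappa t))%R ->
  exists t, (T <= t)%R /\ Im (W t) = 0%R.
Proof.
intros D K.
destruct (classic (exists t, (T <= t)%R /\ Im (W t) = 0%R)) as [H|N]; [assumption|exfalso].
assert (NZ : forall t, (T <= t)%R -> Im (W t) <> 0%R) by (intros t Ht Z; apply N; now exists t).
(* The real part of kappa cancels and the arctangent has derivative - Im kappa <= - 1. Over time 4
   it would drop by 4, at least the length pi of its open range. *)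
assert (H : (atan (Re (W (T + 4)) / Im (W (T + 4))) + (T + 4) <= atan (Re (W T) / Im (W T)) + T)%R).
{ apply (derive_nonpos_le (fun s => atan (Re (W s) / Im (W s)) + s)%R (fun s => - Im (kappa s) + 1)%R T (T + 4)%R ltac:(lra)).
  - intros s Hs. destruct (proj1 (is_Rderive_Re_Im _ _ _) (D s ltac:(lra))) as [D1 D2].
    specialize (NZ s ltac:(lra)).
    apply (is_derive_plus (K := R_AbsRing) (V := R_NormedModule)); [|apply (is_derive_id (K := R_AbsRing))].
    assert (Dq := is_derive_div _ _ s _ _ D1 D2 NZ).
    assert (Da := proj2 (is_derive_Reals _ _ _) (derivable_pt_lim_atan (Re (W s) / Im (W s)))).
    assert (Dc := is_derive_comp (K := R_AbsRing) (V := R_NormedModule) atan _ s _ _ Da Dq).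
    replace (- Im (kappa s))%R with (scal ((Re (kappa s * W s) * Im (W s) - Re (W s) * Im (kappa s * W s)) / Im (W s) ^ 2)%R
       (/ (1 + (Re (W s) / Im (W s)) ^ 2)))%R; [exact Dc|].
    change (((Re (kappa s * W s) * Im (W s) - Re (W s) * Im (kappa s * W s)) / Im (W s) ^ 2) *
       / (1 + (Re (W s) / Im (W s)) ^ 2) = - Im (kappa s))%R.
    rewrite re_mult, im_mult. field. split; [assumption|].
    pose proof (Rle_0_sqr (Re (W s))). assert (P := Rsqr_pos_lt _ NZ). unfold Rsqr in *. lra.
  - intros s Hs. specialize (K s ltac:(lra)). lra. }
pose proof (atan_bound (Re (W (T + 4)%R) / Im (W (T + 4)%R))). pose proof (atan_bound (Re (W T) / Im (W T))).
pose proof PI_4. lra.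
Qed.

(** The equation is invariant under y(t) -> conj(y(-t)), so the half-orbit t >= 0 is reflected to
    negative times; the halves fit at 0 because -1/2 is real. *)
Lemma flow_exists : exists y E : R -> C,
  (forall t, is_Rderive y t (Ci * (1 - y t ^ 3))) /\
  (forall t, (0 <= t)%R -> y (- t)%R = Cconj (y t) /\ y t = omega * (1 - E t) /\
    (Cmod (E t) ^ 2 <= 3 / 4)%R /\ E t <> 0 /\ (Cmod (E t) ^ 2 * (1 + 6 / 10 * t) <= 3 / 4)%R).
Proof.
destruct orbit_exists as [E [E0 HE]].
set (a := fun t => omega * (1 - E t)).
assert (Da : forall t, (0 <= t)%R -> is_Rderive a t (Ci * (1 - a t ^ 3))).
{ intros t Ht. destruct (HE t Ht) as [D _]. unfold a. rewrite Cpow_mult_l, omega_cube.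
  replace (Ci * (1 - 1 * (1 - E t) ^ 3)) with (0 * (1 + - (1) * E t) + omega * (0 + (0 * E t + - (1) * (- rot * (E t * quad (E t)))))).
  - apply is_Rderive_ext_loc with (fun t => omega * (1 + - (1) * E t)) 1%R; [lra|intros; ring|].
    apply (is_Rderive_mult (fun _ => omega)); [apply is_Rderive_const|].
    apply (is_Rderive_plus (fun _ => RtoC 1)); [apply is_Rderive_const|].
    apply (is_Rderive_mult (fun _ => - (1))); [apply is_Rderive_const|exact D].
  - rewrite quad_cube, <- omega_rot. ring. }
assert (a0 : Cconj (a 0%R) = a 0%R).
{ unfold a. rewrite E0. pose proof r3_sqr. unfold omega, orbit_start.
  apply injective_projections; simpl; [ring|]. lra. }
set (b := fun t => Cconj (a (- t)%R)).
exists (glue b a), E. split.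
- intros t. apply is_Rderive_glue.
  + unfold b. now rewrite Ropp_0.
  + intros Ht. assert (G : glue b a t = b t).
    { unfold glue. destruct (Rle_dec 0 t); [|reflexivity]. replace t with 0%R by lra. unfold b. now rewrite Ropp_0. }
    rewrite G. assert (D := is_Rderive_conj_opp a t _ (Da (- t)%R ltac:(lra))).
    replace (Ci * (1 - b t ^ 3)) with (- Cconj (Ci * (1 - a (- t)%R ^ 3))); [exact D|].
    unfold b. rewrite Cmult_conj, Cminus_conj, Cpow_conj.
    replace (Cconj Ci) with (- Ci) by (apply injective_projections; simpl; ring).
    replace (Cconj 1) with (RtoC 1) by (apply injective_projections; simpl; ring). ring.
  + intros Ht. assert (G : glue b a t = a t) by (unfold glue; destruct (Rle_dec 0 t); [reflexivity|lra]).
    rewrite G. auto.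
- intros t Ht. destruct (HE t Ht) as [_ [H1 [H2 H3]]].
  assert (G : glue b a t = a t) by (unfold glue; destruct (Rle_dec 0 t); [reflexivity|lra]).
  split; [|split; [exact G|auto]]. rewrite G. unfold glue. destruct (Rle_dec 0 (- t)).
  + replace t with 0%R by lra. rewrite Ropp_0. now symmetry.
  + unfold b. now rewrite Ropp_involutive.
Qed.

Lemma Cmod_le_of_sqr (z : C) (r : R) : (0 <= r)%R -> (Cmod z ^ 2 <= r ^ 2)%R -> (Cmod z <= r)%R.
Proof. intros Hr H. apply Rnot_lt_le. intros N. pose proof (Cmod_ge_0 z). nra. Qed.

(** At E = 0 the two imaginary parts are 3/2 and sqrt 3 / 2; the radius 1/40 keeps them above 1 and
    0. The first drives the spiralling, the second the transversality. *)
Lemma omega_near (E : C) : (Cmod E <= 1 / 40)%R ->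
  (1 <= Im (- (3) * Ci * (omega * (1 - E)) ^ 2) /\ 0 < Im (omega * (1 - E)))%R.
Proof.
intros H. pose proof (re_le_Cmod E) as H1. pose proof (im_le_Cmod E) as H2.
destruct E as [e f]. unfold Re, Im in *; cbn [fst snd] in *.
assert (K1 : (- (1 / 40) <= e <= 1 / 40)%R) by (apply Rabs_le_between; lra).
assert (K2 : (- (1 / 40) <= f <= 1 / 40)%R) by (apply Rabs_le_between; lra). clear H H1 H2.
pose proof r3_bounds. pose proof r3_sqr.
set (u := (- (1 / 2) * (1 - e) + r3 / 2 * f)%R). set (v := (r3 / 2 * (1 - e) + 1 / 2 * f)%R).
assert (Ey : omega * (1 - (e, f)) = (u, v)).
{ unfold omega, u, v. apply injective_projections; simpl; ring. }
rewrite Ey.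
assert (Hu : (- (54 / 100) <= u <= - (46 / 100))%R) by (unfold u; split; nra).
assert (Hv : (82 / 100 <= v)%R) by (unfold v; nra).
clearbody u v. split; [|simpl; lra]. simpl. nra.
Qed.

Theorem proposition1 :
  exists D : meromorphic_connection,
    Fuchsian D /\
    exists (a b : Rbar) (gamma : R -> CP1),
      geodesic D a b gamma /\
      infinitely_many (self_intersection a b gamma) /\
      ~ dense_CP1 (trace a b gamma).
Proof.
exists connection. split; [apply Fuchsian_connection|].
destruct flow_exists as [y [E [Dy HE]]].
(* Properties invariant under conjugation need checking only for t >= 0, where y is expressed
   through E. *)
assert (Hsym : forall P : C -> Prop, (forall z, P z -> P (Cconj z)) -> (forall t, (0 <= t)%R -> P (y t)) -> forall t, P (y t)).
{ intros P Hc HP t. destruct (Rle_dec 0 t) as [Ht|Ht]; [auto|].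
  destruct (HE (- t)%R ltac:(lra)) as [S _]. rewrite Ropp_involutive in S. rewrite S. apply Hc, HP. lra. }
assert (Hz : forall t, (0 <= t)%R -> 1 - y t ^ 3 = E t * quad (E t)).
{ intros t Ht. destruct (HE t Ht) as [_ [-> _]]. rewrite Cpow_mult_l, omega_cube, quad_cube. ring. }
assert (N1 : forall t, (0 <= t)%R -> 1 - y t ^ 3 <> 0).
{ intros t Ht. rewrite (Hz t Ht). destruct (HE t Ht) as [_ [_ [B [E0 _]]]]. apply Cmult_neq_0; [assumption|].
  intros Z. apply rot_quad_pos in B. rewrite Z, Cmult_0_r in B. simpl in B. lra. }
assert (Low : forall t, (1 / 1000 <= Cmod (y t ^ 3))%R).
{ apply (Hsym (fun w => (1 / 1000 <= Cmod (w ^ 3))%R)).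
  - intros z Hz'. now rewrite <- Cpow_conj, Cmod_conj.
  - intros t Ht. destruct (HE t Ht) as [_ [-> [B _]]]. rewrite Cpow_mult_l, omega_cube, Cmult_1_l, Cmod_pow.
    (* sqrt 3 / 2 < 9/10, so |y| = |1 - E| >= 1/10; the cube is 1/1000. *)
    assert (B' : (Cmod (E t) <= 9 / 10)%R) by (apply Cmod_le_of_sqr; lra).
    assert (T := Cmod_triangle (1 - E t) (E t)). replace (1 - E t + E t) with (RtoC 1) in T by ring. rewrite Cmod_1 in T.
    apply Rle_trans with ((1 / 10) ^ 3)%R; [lra|]. apply pow_incr. lra. }
assert (NZ : forall t, y t ^ 3 <> 0).
{ intros t Z. specialize (Low t). rewrite Z, Cmod_0 in Low. lra. }
assert (NO : forall t, y t ^ 3 <> 1).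
{ apply (Hsym (fun w => w ^ 3 <> 1)).
  - intros z Hz' Z. apply Hz'. rewrite <- (Cconj_conj z), <- Cpow_conj, Z. apply injective_projections; simpl; ring.
  - intros t Ht Z. apply (N1 t Ht). rewrite Z. ring. }
assert (Lim : forall eps, (0 < eps)%R -> exists T, (0 <= T)%R /\ forall t, (T <= t)%R -> (Cmod (E t) <= eps)%R).
{ intros eps He. assert (e2 : (0 < eps ^ 2)%R) by now apply pow_lt.
  (* With t eps^2 >= 2, |E| > eps would give |E|^2 (1 + 6/10 t) > 12/10, above the bound 3/4. *)
  exists (2 / eps ^ 2)%R. assert (0 < 2 / eps ^ 2)%R by (apply Rdiv_lt_0_compat; lra). split; [lra|].
  intros t Ht. destruct (HE t ltac:(lra)) as [_ [_ [_ [_ B]]]]. apply Cmod_le_of_sqr; [lra|].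
  assert (X : (2 <= t * eps ^ 2)%R) by (apply Rle_div_l in Ht; assumption).
  pose proof (pow_le _ 2 (Cmod_ge_0 (E t))). apply Rnot_lt_le. intros N.
  assert (eps ^ 2 * (1 + 6 / 10 * t) < Cmod (E t) ^ 2 * (1 + 6 / 10 * t))%R by (apply Rmult_lt_compat_r; lra). lra. }
set (gamma := fun t => Some (y t ^ 3) : CP1).
exists m_infty, p_infty, gamma. split; [now apply cube_geodesic|split].
- destruct (Lim (1 / 40)%R ltac:(lra)) as [T0 [HT0 Small]].
  assert (Cross : forall T, (T0 <= T)%R -> exists t, (T <= t)%R /\ self_intersection m_infty p_infty gamma (gamma t)).
  { intros T HT.
    (* W = 1 - z satisfies W' = - 3 y^2 y' = (- 3 i y^2) W, and W is real exactly when z is. *)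
    destruct (spiral_real (fun t => 1 - y t ^ 3) (fun t => - (3) * Ci * y t ^ 2) T) as [t [Ht Z]].
    - intros t Ht. assert (D := pderiv_correct y t (PAdd (PC 1) (PMul (PC (- (1))) pcube)) (Dy t)).
      simpl in D.
      apply is_Rderive_ext_loc with (fun s => 1 + - (1) * (y s * (y s * y s))) 1%R; [lra|intros; simpl; ring|].
      replace (- (3) * Ci * y t ^ 2 * (1 - y t ^ 3)) with
       (0 + (0 * (y t * (y t * y t)) + - (1) * (Ci * (1 + - (1) * (y t * (y t * y t))) * (y t * y t) + 
         y t * (Ci * (1 + - (1) * (y t * (y t * y t))) * y t + y t * (Ci * (1 + - (1) * (y t * (y t * y t)))))))) by (simpl; ring).
      exact D.
    - intros t Ht. destruct (HE t ltac:(lra)) as [_ [-> _]]. apply omega_near, Small. lra.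
    - exists t. split; [assumption|].
      destruct (HE t ltac:(lra)) as [Sy [Ey _]].
      assert (Iy : (0 < Im (y t))%R) by (rewrite Ey; apply omega_near, Small; lra).
      set (w := y t) in *.
      assert (Rz : Cconj (w ^ 3) = w ^ 3).
      { apply injective_projections; simpl in Z |- *; unfold Im in Z; simpl in Z; lra. }
      exists t, (- t)%R, (cube_lift (y t ^ 3) y), (cube_lift (y (- t)%R ^ 3) y).
      repeat split.
      + unfold gamma. rewrite Sy, <- Cpow_conj. now rewrite Rz.
      + apply cube_smooth_lift, Dy.
      + apply cube_smooth_lift, Dy.
      + apply cube_smooth_lift, Dy.
      + apply cube_smooth_lift, Dy.
      + unfold R_independent. rewrite !cube_lift_1, Sy. fold w.
        set (rho := Re (w ^ 3)). assert (Er : w ^ 3 = RtoC rho).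
        { apply injective_projections; [reflexivity|]. assert (G := f_equal snd Rz). simpl in G |- *. lra. }
        assert (Rho0 : rho <> 0%R) by (intros X; apply (NZ t); fold w; now rewrite Er, X).
        assert (Rho1 : (1 - rho)%R <> 0%R).
        { intros X. apply (NO t). fold w. rewrite Er. f_equal. lra. }
        (* With w^3 = rho real, one velocity times the conjugate of the other is 9 w^4 (1 - rho)^2,
           a nonzero real multiple of w, and Im w > 0. *)
        replace (3 * w ^ 2 * (Ci * (1 - w ^ 3)) * Cconj (3 * Cconj w ^ 2 * (Ci * (1 - Cconj w ^ 3)))) with
          (RtoC (9 * (rho * (1 - rho) ^ 2)) * w).
        * rewrite im_scal_l. apply Rmult_integral_contrapositive. split; [|lra].
          apply Rmult_integral_contrapositive. split; [lra|].
          apply Rmult_integral_contrapositive. split; [assumption|now apply pow_nonzero].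
        * rewrite !Cmult_conj, Cminus_conj, Cpow_conj, Cpow_conj, Cconj_conj.
          replace (Cconj Ci) with (- Ci) by (apply injective_projections; simpl; ring).
          replace (Cconj 1) with (RtoC 1) by (apply injective_projections; simpl; ring).
          replace (Cconj 3) with (RtoC 3) by (apply injective_projections; simpl; ring).
          assert (CC : Ci * Ci = - (1)) by (apply injective_projections; simpl; ring).
          transitivity (- (Ci * Ci) * 9 * (w ^ 3 * w) * (1 - w ^ 3) ^ 2); [|simpl; ring].
          rewrite CC, Er, !RtoC_mult, RtoC_pow, RtoC_minus. ring. }
  intros [l Hl].
  (* The curve tends to 1 without reaching it, so it eventually avoids any finite list; a later
     crossing then lies outside [l]. *)
  assert (Out : forall l : list CP1, exists T, (T0 <= T)%R /\ forall t, (T <= t)%R -> ~ In (gamma t) l).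
  { clear l Hl. induction l as [|q l [T [HT IH]]].
    - exists T0. split; [lra|]. intros t _ [].
    - destruct (classic (exists z, q = Some z /\ z <> 1)) as [[z [-> Nz]]|Nq].
      + assert (Pz : (0 < Cmod (1 - z))%R).
        { apply Cmod_gt_0. apply Cminus_eq_contra. congruence. }
        (* |E| <= 1 gives |1 - z(t)| = |E| |quad E| <= 7 |E|, so the denominator 8 separates the
           curve from the listed point. *)
        destruct (Lim (Rmin 1 (Cmod (1 - z) / 8))) as [T1 [HT1 S1]].
        { apply Rmin_pos; lra. }
        exists (Rmax T T1). split; [eapply Rle_trans; [apply HT|apply Rmax_l]|].
        intros t Ht. assert (t1 : (T1 <= t)%R) by (eapply Rle_trans; [apply Rmax_r|apply Ht]).
        assert (t2 : (T <= t)%R) by (eapply Rle_trans; [apply Rmax_l|apply Ht]).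
        intros [K|K]; [|now apply (IH t t2)].
        injection K as K'. assert (K : z = y t ^ 3) by exact K'. specialize (S1 t t1). rewrite K, (Hz t ltac:(lra)) in Pz. rewrite K, (Hz t ltac:(lra)) in S1.
        assert (A1 : (Cmod (E t) <= 1)%R) by (eapply Rle_trans; [apply S1|apply Rmin_l]).
        assert (A2 := Rle_trans _ _ _ S1 (Rmin_r _ _)). apply quad_bound in A1.
        rewrite Cmod_mult in Pz, A2. pose proof (Cmod_ge_0 (E t)). nra.
      + exists T. split; [assumption|]. intros t Ht [K|K]; [|now apply (IH t Ht)].
        apply Nq. exists (y t ^ 3). split; [now symmetry|apply NO]. }
  destruct (Out l) as [T [HT H]]. destruct (Cross T HT) as [t [Ht S]].
  apply (H t Ht), Hl, S.
- intros H.
  (* The disc |z| < 1/1000 contains 0 and misses the curve by [Low]. In the chart at infinity it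
     reads |u| > 1000. *)
  destruct (H (fun q => match q with Some z => (Cmod z < 1 / 1000)%R | None => False end)) as [q [Uq [t [_ Et]]]].
  + intros p u Hu. change C in u. apply locally_C_iff. destruct p as [a|]; simpl in Hu |- *.
    * exists (1 / 1000 - Cmod (a + u))%R. split; [lra|]. intros w Hw.
      pose proof (Cmod_triangle (a + u) (w - u)) as T. replace (a + u + (w - u)) with (a + w) in T by ring. lra.
    * destruct (Ceq_dec u 0) as [->|N]; [contradiction|].
      rewrite Cmod_inv in Hu by assumption. assert (Pu := proj1 (Cmod_gt_0 u) N).
      assert (Lu : (1000 < Cmod u)%R).
      { apply Rmult_lt_reg_l with (/ Cmod u)%R; [now apply Rinv_0_lt_compat|]. rewrite Rinv_l by lra. lra. }
      exists (Cmod u - 1000)%R. split; [lra|]. intros w Hw. change C in w.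
      assert (Lw : (1000 < Cmod w)%R).
      { pose proof (Cmod_triangle w (- (w - u))) as T. rewrite Cmod_opp in T. replace (w + - (w - u)) with u in T by ring. lra. }
      assert (Nw : w <> 0) by (apply Cmod_gt_0; lra).
      destruct (Ceq_dec w 0); [contradiction|]. rewrite Cmod_inv by assumption.
      replace (1 / 1000)%R with (/ 1000)%R by lra. apply Rinv_lt_contravar; [nra|assumption].
  + exists (Some (RtoC 0)). rewrite Cmod_0. lra.
  + rewrite <- Et in Uq. simpl in Uq. specialize (Low t). simpl in Low. lra.
Qed.
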